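(* Let $\mathfrak n$ be the $6$-dimensional nilpotent Lie algebra with basis $e_1,\dots,e_6$ whose only non-trivial brackets are (up to isomorphism) $e_2=[e_5,e_4]$, $e_3=[e_6,e_4]=[e_1,e_5]$. Let $m\neq 0$ be a real number and let $S\cong\mathbb R^7$ be the simply connected solvable Lie group with Lie algebra $\mathfrak s=\mathfrak n\oplus\mathbb R e_7$ described in the context, with its global coordinates $(x_1,\dots,x_6,t)$. Then $S$ carries the Riemannian metric $$g=e^{-2mt}dt^2+e^{-\frac25 mt}(dx_1^2+dx_6^2)+e^{-\frac45 mt}(dx_4^2+dx_5^2)+\tfrac9{25}m^2e^{\frac45 mt}\bigl(dx_3-\tfrac23x_1dx_5+\tfrac23x_4dx_6\bigr)^2+\tfrac9{25}m^2e^{\frac25 mt}\bigl(dx_2+\tfrac23x_4dx_5\bigr)^2,$$ whose holonomy group is precisely $G_2$.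
   Context: The Lie algebra $\mathfrak s$ is given, in terms of a basis $e^1,\dots,e^7$ of its dual and the Chevalley--Eilenberg differential ($d\alpha(X,Y)=-\alpha([X,Y])$, $e^{ij}=e^i\wedge e^j$), by $$de^1=-\tfrac45me^{17},\quad de^2=-\tfrac65me^{27}-\tfrac25me^{45},\quad de^3=-\tfrac75me^{37}+\tfrac25m(e^{15}-e^{46}),$$ $$de^4=-\tfrac35me^{47},\quad de^5=-\tfrac35me^{57},\quad de^6=-\tfrac45me^{67},\quad de^7=0.$$ (After rescaling the basis, $\mathfrak n=\mathrm{span}\{e_1,\dots,e_6\}$ has the brackets in the claim.) Global coordinates $(x_1,\dots,x_6,t)$ on $S$ are chosen so that the left-invariant forms are $$e^i=e^{\frac45mt}dx_i\ (i=1,6),\quad e^l=e^{\frac35mt}dx_l\ (l=4,5),\quad e^7=dt,$$ $$e^2=-\tfrac35m\,e^{\frac65mt}\bigl(dx_2+\tfrac23x_4dx_5\bigr),\quad e^3=-\tfrac35m\,e^{\frac75mt}\bigl(dx_3-\tfrac23x_1dx_5+\tfrac23x_4dx_6\bigr).$$ The metric in the claim equals $e^{-2mt}\sum_{i=1}^7(e^i)^2$. *)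

(* Defs.v *)
From mathcomp Require Import all_boot all_order all_algebra.
From mathcomp Require Import all_classical all_reals all_analysis.
From mathcomp Require Import ring lra.

Set Implicit Arguments.
Unset Strict Implicit.
Unset Printing Implicit Defensive.

Import Order.TTheory GRing.Theory Num.Theory.
Import numFieldNormedType.Exports.

Local Open Scope classical_set_scope.
Local Open Scope ring_scope.

(* Tangent vectors of R^n are row vectors; 'e_i is the i-th coordinate vector
   field. A linear endomorphism of a tangent space is a matrix A acting by
   v |-> v *m A. *)
Notation "''e_' i" := (delta_mx 0 i) (at level 8, i at level 2).

Section Smooth.
Context {R : realType} {V : normedModType R}.

(* On a finite-dimensional V this is the usual C^k: directional derivatives
   along all constant directions exist and are continuous up to order k. *)
Fixpoint Ck (k : nat) (f : V -> R) : Prop :=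
  continuous f /\
  match k with
  | 0 => True
  | k'.+1 => forall v, (forall x, derivable f x v) /\ Ck k' ('D_v f)
  end.

Definition smooth (f : V -> R) : Prop := forall k, Ck k f.

End Smooth.

Section Riemannian.
Context {R : realType} {n : nat}.
Implicit Types (x p q : 'rV[R]_n) (A B : 'M[R]_n).

(* A field of bilinear forms: g x u v is g_x(u, v). *)
Definition bilinear_field := 'rV[R]_n -> 'rV[R]_n -> 'rV[R]_n -> R.
Implicit Types g : bilinear_field.

Definition riemannian g : Prop :=
  [/\ forall x u, linear (g x u : _ -> R^o),
      forall x u v, g x u v = g x v u,
      forall x u, u != 0 -> 0 < g x u u &
      forall u v, smooth (fun x => g x u v)].

Definition gram g x : 'M[R]_n := \matrix_(i, j) g x 'e_i 'e_j.

(* Gamma^k_ij of the Levi-Civita connection *)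
Definition christoffel g x (k i j : 'I_n) : R :=
  2^-1 * \sum_(l < n) invmx (gram g x) k l *
    ('D_('e_i) (fun y => gram g y j l) x
     + 'D_('e_j) (fun y => gram g y i l) x
     - 'D_('e_l) (fun y => gram g y i j) x).

Definition smooth_curve (c : R -> 'rV[R]_n) : Prop :=
  forall i, smooth (fun s : R => c s 0 i).

(* V is a parallel vector field along the arc c restricted to [0, 1]. *)
Definition parallel_along g (c V : R -> 'rV[R]_n) : Prop :=
  forall s : R, 0 <= s <= 1 -> forall k,
    is_derive s 1 (fun r : R => V r 0 k)
      (- \sum_(i < n) \sum_(j < n)
           christoffel g (c s) k i j * derive1 (fun r : R => c r 0 i) s * V s 0 j).

(* [transport g p q A]: A is the parallel transport T_p -> T_q along some
   piecewise smooth curve from p to q. *)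
Inductive transport g : 'rV[R]_n -> 'rV[R]_n -> 'M[R]_n -> Prop :=
| transport_arc (c : R -> 'rV[R]_n) A :
    smooth_curve c ->
    (forall v, exists2 V, parallel_along g c V & V 0 = v /\ V 1 = v *m A) ->
    transport g (c 0) (c 1) A
| transport_cat p q r A B :
    transport g p q A -> transport g q r B -> transport g p r (A *m B).

Definition holonomy g p A : Prop := transport g p p A.

Definition orthonormal_frame g p (F : 'M[R]_n) : Prop :=
  forall i j, g p (row i F) (row j F) = (i == j)%:R.

End Riemannian.
Arguments bilinear_field : clear implicits.

Section Forms.
Context {R : realType} {n : nat}.

(* Coordinates are numbered from 1. *)
Definition dx (k : nat) (u : 'rV[R]_n.+1) : R := u 0 (inord k.-1).

Definition wedge2 (a b : 'rV[R]_n.+1 -> R) (u v : 'rV[R]_n.+1) : R :=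
  a u * b v - b u * a v.

Definition wedge3 (a b c : 'rV[R]_n.+1 -> R) (u v w : 'rV[R]_n.+1) : R :=
  a u * wedge2 b c v w + a v * wedge2 b c w u + a w * wedge2 b c u v.

(* Exterior derivative of a 1-form, evaluated on constant vector fields. *)
Definition ext_d (a : 'rV[R]_n.+1 -> 'rV[R]_n.+1 -> R) x u v : R :=
  'D_u (fun y => a y v) x - 'D_v (fun y => a y u) x.

End Forms.

Section G2.
Context {R : realType}.

Definition phi0 (u v w : 'rV[R]_7) : R :=
  let e i j k := wedge3 (dx i) (dx j) (dx k) u v w in
  e 1 2 3 + e 1 4 5 + e 1 6 7 + e 2 4 6 - e 2 5 7 - e 3 4 7 - e 3 5 6.

Definition G2 (A : 'M[R]_7) : Prop :=
  A \in unitmx /\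
  forall u v w, phi0 (u *m A) (v *m A) (w *m A) = phi0 u v w.

(* At every point p, Hol_p is G2 when T_p is identified with R^7 through
   a suitable g-orthonormal basis, given by the rows of F. *)
Definition holonomy_is_G2 (g : bilinear_field R 7) : Prop :=
  forall p, exists2 F, orthonormal_frame g p F &
    forall A, holonomy g p A <-> G2 (F *m A *m invmx F).

End G2.

(* Lie group structures on the manifold R^n; simply connected, and every
   simply connected solvable Lie group is of this form. *)
Record lie_group (R : realType) (n : nat) := LieGroup {
  lg_mul : 'rV[R]_n -> 'rV[R]_n -> 'rV[R]_n;
  lg_one : 'rV[R]_n;
  lg_inv : 'rV[R]_n -> 'rV[R]_n;
  lg_mulA : associative lg_mul;
  lg_mul1 : left_id lg_one lg_mul;
  lg_mulV : left_inverse lg_one lg_inv lg_mul;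
  lg_mul_smooth : forall k,
    smooth (fun z : 'rV[R]_n * 'rV[R]_n => lg_mul z.1 z.2 0 k);
  lg_inv_smooth : forall k, smooth (fun x => lg_inv x 0 k)
}.

(* theta x u 0 k is theta^k_x(u). The Lie algebra of S is R^n with bracket br,
   the standard basis being dual to the left-invariant coframe theta:
   d theta^k (X, Y) = - theta^k [X, Y]. *)
Definition lie_algebra_via (R : realType) (n : nat) (S : lie_group R n.+1)
    (theta : 'rV[R]_n.+1 -> 'rV[R]_n.+1 -> 'rV[R]_n.+1)
    (br : 'rV[R]_n.+1 -> 'rV[R]_n.+1 -> 'rV[R]_n.+1) : Prop :=
  [/\ forall x, linear (theta x) /\ injective (theta x),
      forall u k, smooth (fun x => theta x u 0 k),
      forall a x u, theta (lg_mul S a x) ('D_u (lg_mul S a) x) = theta x u &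
      forall x u v k, ext_d (fun y w => theta y w 0 k) x u v
                      = - br (theta x u) (theta x v) 0 k].

Section Solvmanifold.
Context {R : realType}.
Context (m : R).

Definition n_bracket (X Y : 'rV[R]_6) : 'rV[R]_6 :=
  let e i j := wedge2 (dx i) (dx j) X Y in
  \row_k [:: 0; e 5 4; e 6 4 + e 1 5; 0; 0; 0]`_k.

(* The Chevalley-Eilenberg differentials de^1, ..., de^7. *)
Definition s_de (X Y : 'rV[R]_7) : 'rV[R]_7 :=
  let e i j := wedge2 (dx i) (dx j) X Y in
  \row_k [:: - (4 / 5) * m * e 1 7;
             - (6 / 5) * m * e 2 7 - (2 / 5) * m * e 4 5;
             - (7 / 5) * m * e 3 7 + (2 / 5) * m * (e 1 5 - e 4 6);
             - (3 / 5) * m * e 4 7;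
             - (3 / 5) * m * e 5 7;
             - (4 / 5) * m * e 6 7;
             0]`_k.

Definition s_bracket (X Y : 'rV[R]_7) : 'rV[R]_7 := - s_de X Y.

Implicit Types x u v : 'rV[R]_7.

Definition eta2 x u : R := dx 2 u + (2 / 3) * dx 4 x * dx 5 u.
Definition eta3 x u : R :=
  dx 3 u - (2 / 3) * dx 1 x * dx 5 u + (2 / 3) * dx 4 x * dx 6 u.

(* The forms e^1, ..., e^7; the seventh coordinate is t. *)
Definition coframe x u : 'rV[R]_7 :=
  let t := dx 7 x in
  \row_k [:: expR ((4 / 5) * m * t) * dx 1 u;
             - (3 / 5) * m * expR ((6 / 5) * m * t) * eta2 x u;
             - (3 / 5) * m * expR ((7 / 5) * m * t) * eta3 x u;
             expR ((3 / 5) * m * t) * dx 4 u;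
             expR ((3 / 5) * m * t) * dx 5 u;
             expR ((4 / 5) * m * t) * dx 6 u;
             dx 7 u]`_k.

Definition metric : bilinear_field R 7 := fun x u v =>
  let t := dx 7 x in
  expR (- 2 * m * t) * (dx 7 u * dx 7 v)
  + expR (- (2 / 5) * m * t) * (dx 1 u * dx 1 v + dx 6 u * dx 6 v)
  + expR (- (4 / 5) * m * t) * (dx 4 u * dx 4 v + dx 5 u * dx 5 v)
  + (9 / 25) * m ^+ 2 * expR ((4 / 5) * m * t) * (eta3 x u * eta3 x v)
  + (9 / 25) * m ^+ 2 * expR ((2 / 5) * m * t) * (eta2 x u * eta2 x v).

(* s = n + R e_7: the span of e_1, ..., e_6 is a subalgebra isomorphic to n. *)
Definition extends_n : Prop :=
  exists f : 'rV[R]_6 -> 'rV[R]_7,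
    [/\ linear f, injective f,
        range f = [set X | dx 7 X = 0] &
        forall X Y, f (n_bracket X Y) = s_bracket (f X) (f Y)].

Definition solvable_group_S (S : lie_group R 7) : Prop :=
  extends_n /\ lie_algebra_via S coframe s_bracket.

End Solvmanifold.

Section IsDerive.
Context {R : realType} {V : normedModType R}.
Implicit Types (f g : V -> R) (x v : V).

Lemma is_derive_add f g x v (a b : R) : is_derive x v f a ->
  is_derive x v g b -> is_derive x v (fun y => f y + g y) (a + b).
Proof. by move=> fa gb; exact: is_deriveD. Qed.

Lemma is_derive_mul f g x v (a b : R) : is_derive x v f a ->
  is_derive x v g b -> is_derive x v (fun y => f y * g y) (f x * b + g x * a).
Proof. by move=> fa gb; exact: is_deriveM. Qed.

End IsDerive.

Section SmoothTheory.
Context {R : realType} {V : normedModType R}.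
Implicit Types (f g : V -> R) (x v : V).

Lemma is_derive_line f x v (d : R) :
  is_derive x v f d <-> is_derive (0 : R) 1 (fun h : R => f (h *: v + x)) d.
Proof.
have E : (fun h : R => h^-1 *: ((f \o shift x) (h *: v) - f x))
       = (fun h : R => h^-1 *: (((fun k : R => f (k *: v + x)) \o shift 0)
                                 (h *: 1) - f (0 *: v + x))).
  by apply/funext => h /=; rewrite scale0r add0r addr0 [h *: 1]mulr1.
split=> -[e1 e2]; split.
- by move: e1; rewrite /derivable E.
- by move: e2; rewrite /derive E.
- by rewrite /derivable E.
- by rewrite /derive E.
Qed.

Lemma is_derive_lin f x v : linear (f : V -> R^o) -> is_derive x v f (f v).
Proof.
move=> lf; have E : (fun h : R => f (h *: v + x)) = (fun h => h * f v + f x).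
  by apply/funext => h; rewrite lf.
apply/is_derive_line; rewrite E -[X in is_derive _ _ _ X]addr0.
apply: is_derive_add; rewrite -[X in is_derive _ _ _ X]add0r.
rewrite -[X in _ + X]mulr1 -[X in X + _](mul0r 0).
exact: (@is_derive_mul _ _ id (cst (f v)) 0 1 1 0 (is_derive_id _ _)
  (is_derive_cst _ _ _)).
Qed.

Lemma is_derive_exp f x v (a : R) : is_derive x v f a ->
  is_derive x v (fun y => expR (f y)) (expR (f x) * a).
Proof.
move=> /is_derive_line fa; apply/is_derive_line.
rewrite -[in X in is_derive _ _ _ X](add0r x) -[in X in is_derive _ _ _ X](scale0r v).
exact: (@is_derive1_comp _ expR _ _ _ _ (is_derive_expR _) fa).
Qed.

Lemma Ck_cont k f : Ck k f -> continuous f.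
Proof. by case: k => [|k] []. Qed.

Lemma CkW k f : Ck k.+1 f -> Ck k f.
Proof.
elim: k f => [f [cf _]|k IH f [cf H]]; first by split.
by split=> // v; have [df /IH] := H v.
Qed.

Lemma Ck_cst k (a : R) : Ck k (fun _ : V => a).
Proof.
elim: k a => [|k IH] a; (split; first exact: cst_continuous) => // v.
split=> [x|]; first exact: derivable_cst.
rewrite (_ : 'D_v _ = fun=> 0) //.
by apply/funext => x; exact: (derive_cst a).
Qed.

Lemma Ck_lin k f : continuous f -> linear (f : V -> R^o) -> Ck k f.
Proof.
move=> cf lf; case: k => [|k]; split=> // v; split=> [x|].
  exact: (@ex_derive _ _ _ _ _ _ _ (is_derive_lin x v lf)).
rewrite (_ : 'D_v _ = fun=> f v); first exact: Ck_cst.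
by apply/funext => x; exact: (@derive_val _ _ _ _ _ _ _ (is_derive_lin x v lf)).
Qed.

Lemma CkD k f g : Ck k f -> Ck k g -> Ck k (fun x => f x + g x).
Proof.
elim: k f g => [|k IH] f g [cf Hf] [cg Hg];
  (split; first by move=> x; exact: (continuousD (cf x) (cg x))) => // v.
have [df Cf] := Hf v; have [dg Cg] := Hg v.
split=> [x|]; first exact: derivableD.
rewrite (_ : 'D_v _ = fun x => 'D_v f x + 'D_v g x); first exact: IH.
by apply/funext => x; exact: deriveD.
Qed.

Lemma CkM k f g : Ck k f -> Ck k g -> Ck k (fun x => f x * g x).
Proof.
elim: k f g => [|k IH] f g Hf Hg; move: (Hf) (Hg) => [cf Df] [cg Dg];
  (split; first by move=> x; exact: (continuousM (cf x) (cg x))) => // v.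
have [df Cf] := Df v; have [dg Cg] := Dg v.
split=> [x|]; first exact: derivableM.
rewrite (_ : 'D_v _ = fun x => f x * 'D_v g x + g x * 'D_v f x).
  by apply: CkD; apply: IH => //; exact: CkW.
by apply/funext => x; exact: deriveM.
Qed.

Lemma CkE k f : Ck k f -> Ck k (fun x => expR (f x)).
Proof.
elim: k f => [|k IH] f Hf; move: (Hf) => [cf Df];
  (split; first by move=> x; apply: continuous_comp; [exact: cf|exact: continuous_expR])
  => // v.
have [df Cf] := Df v.
have dE x : is_derive x v (fun x => expR (f x)) (expR (f x) * 'D_v f x).
  by apply: is_derive_exp; apply: derivableP.
split=> [x|]; first exact: (@ex_derive _ _ _ _ _ _ _ (dE x)).
rewrite (_ : 'D_v _ = fun x => expR (f x) * 'D_v f x).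
  by apply: CkM => //; apply: IH; exact: CkW.
by apply/funext => x; exact: (@derive_val _ _ _ _ _ _ _ (dE x)).
Qed.

Lemma smoothD f g : smooth f -> smooth g -> smooth (fun x => f x + g x).
Proof. by move=> ? ? k; exact: CkD. Qed.

Lemma smoothM f g : smooth f -> smooth g -> smooth (fun x => f x * g x).
Proof. by move=> ? ? k; exact: CkM. Qed.

Lemma smooth_expR f : smooth f -> smooth (fun x => expR (f x)).
Proof. by move=> ? k; exact: CkE. Qed.

Lemma smooth_cst (a : R) : smooth (fun _ : V => a).
Proof. by move=> k; exact: Ck_cst. Qed.

Lemma smoothN f : smooth f -> smooth (fun x => - f x).
Proof.
move=> sf; rewrite (_ : (fun _ => _) = fun x => -1 * f x).
  by apply: smoothM => //; exact: smooth_cst.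
by apply/funext => x; rewrite mulN1r.
Qed.

End SmoothTheory.

Section DxTheory.
Context {R : realType} {n : nat}.
Local Notation V := 'rV[R]_n.+1.

Lemma dx_linear k : linear (dx k : V -> R^o).
Proof. by move=> a u v; rewrite /dx !mxE. Qed.

Lemma dxD k (u v : V) : dx k (u + v) = dx k u + dx k v.
Proof. by rewrite /dx !mxE. Qed.

Lemma dxZ k (a : R) (u : V) : dx k (a *: u) = a * dx k u.
Proof. by rewrite /dx !mxE. Qed.

Lemma dx_row k (s : nat -> R) : (k.-1 < n.+1)%N ->
  dx k (\row_(i < n.+1) s i : V) = s k.-1.
Proof. by move=> kn; rewrite /dx mxE inordK. Qed.

Lemma dx_ext (u v : V) : (forall k, (k < n.+1)%N -> dx k.+1 u = dx k.+1 v) -> u = v.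
Proof.
by move=> E; apply/rowP => k; have := E k (ltn_ord k); rewrite /dx inord_val.
Qed.

Lemma smooth_dx k : smooth (dx k : V -> R).
Proof. by move=> l; apply: Ck_lin; [exact: coord_continuous|exact: dx_linear]. Qed.

Lemma smooth_dx1 k : smooth (fun z : V * V => dx k z.1).
Proof.
move=> l; apply: Ck_lin; last by move=> a u v; rewrite dx_linear.
move=> z; apply: (@continuous_comp _ _ _ fst (dx k)); first exact: cvg_fst.
exact: coord_continuous.
Qed.

Lemma smooth_dx2 k : smooth (fun z : V * V => dx k z.2).
Proof.
move=> l; apply: Ck_lin; last by move=> a u v; rewrite dx_linear.
move=> z; apply: (@continuous_comp _ _ _ snd (dx k)); first exact: cvg_snd.
exact: coord_continuous.
Qed.

End DxTheory.

Section Existence.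
Context {R : realType}.
Context (m : R).
Implicit Types a x y u v : 'rV[R]_7.

Lemma metric_coframe x u v :
  metric m x u v
  = expR (- 2 * m * dx 7 x) * \sum_(k < 7) coframe m x u 0 k * coframe m x v 0 k.
Proof.
rewrite 7!big_ord_recl big_ord0 !mxE /= addr0 /metric; set t := dx 7 x.
have E r s q : r = s + q + q ->
    expR (r * m * t) = expR (s * m * t) * expR (q * m * t) ^+ 2.
  by move=> ->; rewrite expr2 -!expRD; congr expR; ring.
rewrite (E (- (2 / 5)) (- 2) (4 / 5)); last by field.
rewrite (E (- (4 / 5)) (- 2) (3 / 5)); last by field.
rewrite (E (4 / 5) (- 2) (7 / 5)); last by field.
rewrite (E (2 / 5) (- 2) (6 / 5)); last by field.
by field.
Qed.

(* The group law of S in the coordinates (x_1, ..., x_6, t). *)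
Definition S_mul a x : 'rV[R]_7 :=
  let l k := expR (- (k / 5) * m * dx 7 a) in
  \row_i [:: dx 1 a + l 4 * dx 1 x;
             dx 2 a + l 6 * dx 2 x - (2 / 3) * (dx 4 a * (l 3 * dx 5 x));
             dx 3 a + l 7 * dx 3 x
               + (2 / 3) * (dx 1 a * (l 3 * dx 5 x) - dx 4 a * (l 4 * dx 6 x));
             dx 4 a + l 3 * dx 4 x;
             dx 5 a + l 3 * dx 5 x;
             dx 6 a + l 4 * dx 6 x;
             dx 7 a + dx 7 x]`_i.

Definition S_inv a : 'rV[R]_7 :=
  let l k := expR (k / 5 * m * dx 7 a) in
  \row_i [:: - (l 4 * dx 1 a);
             - (l 6 * (dx 2 a + (2 / 3) * (dx 4 a * dx 5 a)));
             - (l 7 * (dx 3 a - (2 / 3) * (dx 1 a * dx 5 a - dx 4 a * dx 6 a)));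
             - (l 3 * dx 4 a);
             - (l 3 * dx 5 a);
             - (l 4 * dx 6 a);
             - dx 7 a]`_i.

Lemma dx_list k (s : seq R) : (k.-1 < 7)%N ->
  dx k (\row_(i < 7) s`_i) = s`_(k.-1).
Proof. exact: (@dx_row _ _ k (nth 0 s)). Qed.

Lemma dxN k u : dx k (- u) = - dx k u.
Proof. by rewrite /dx mxE. Qed.

Lemma dxB k u v : dx k (u - v) = dx k u - dx k v.
Proof. by rewrite dxD dxN. Qed.

Lemma S_mulA : associative S_mul.
Proof.
move=> a x y; apply: dx_ext.
have E r : expR (- (r / 5) * m * (dx 7 a + dx 7 x))
         = expR (- (r / 5) * m * dx 7 a) * expR (- (r / 5) * m * dx 7 x).
  by rewrite -expRD; congr expR; ring.
have P : expR (- (7 / 5) * m * dx 7 a)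
       = expR (- (3 / 5) * m * dx 7 a) * expR (- (4 / 5) * m * dx 7 a).
  by rewrite -expRD; congr expR; field.
have Q : expR (- (6 / 5) * m * dx 7 a)
       = expR (- (3 / 5) * m * dx 7 a) * expR (- (3 / 5) * m * dx 7 a).
  by rewrite -expRD; congr expR; field.
move=> k kn; rewrite /S_mul !dx_list //.
by case: k kn => [|[|[|[|[|[|[|k]]]]]]] //= _; rewrite ?E ?P ?Q; field.
Qed.

Lemma dx0 k : dx k (0 : 'rV[R]_7) = 0.
Proof. by rewrite /dx mxE. Qed.

Lemma S_mul1 : left_id 0 S_mul.
Proof.
move=> x; apply: dx_ext.
move=> k kn; rewrite /S_mul !dx_list //.
by case: k kn => [|[|[|[|[|[|[|k]]]]]]] //= _; rewrite !dx0 ?mulr0 ?mul0r ?expR0; ring.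
Qed.

Lemma S_mulV : left_inverse 0 S_inv S_mul.
Proof.
move=> x; apply: dx_ext.
have E r : - (r / 5) * m * - dx 7 x = r / 5 * m * dx 7 x by ring.
have P : expR (7 / 5 * m * dx 7 x)
       = expR (3 / 5 * m * dx 7 x) * expR (4 / 5 * m * dx 7 x).
  by rewrite -expRD; congr expR; field.
have Q : expR (6 / 5 * m * dx 7 x)
       = expR (3 / 5 * m * dx 7 x) * expR (3 / 5 * m * dx 7 x).
  by rewrite -expRD; congr expR; field.
move=> k kn; rewrite dx0 /S_mul !dx_list //.
by case: k kn => [|[|[|[|[|[|[|k]]]]]]] //= _; rewrite ?E ?P ?Q; field.
Qed.

Ltac smooth_tac := repeat first
  [ exact: smooth_dx | exact: smooth_dx1 | exact: smooth_dx2 | exact: smooth_cst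
  | apply: smoothD | apply: smoothM | apply: smoothN | apply: smooth_expR ].

Lemma smooth_row (V : normedModType R) (f : V -> 'rV[R]_7) :
  (forall k, (k < 7)%N -> smooth (fun z => dx k.+1 (f z))) ->
  forall i, smooth (fun z => f z 0 i).
Proof. by move=> H i; have := H i (ltn_ord i); rewrite /dx /= inord_val. Qed.

Lemma S_mul_smooth i : smooth (fun z : 'rV[R]_7 * 'rV[R]_7 => S_mul z.1 z.2 0 i).
Proof.
move: i; apply: smooth_row => k kn.
rewrite (_ : (fun _ => _) = (fun z => dx k.+1 (S_mul z.1 z.2))) // /S_mul.
under eq_fun do rewrite dx_list //.
by case: k kn => [|[|[|[|[|[|[|k]]]]]]] //= _; smooth_tac.
Qed.

Lemma S_inv_smooth i : smooth (fun x => S_inv x 0 i).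
Proof.
move: i; apply: smooth_row => k kn; rewrite /S_inv.
under eq_fun do rewrite dx_list //.
by case: k kn => [|[|[|[|[|[|[|k]]]]]]] //= _; smooth_tac.
Qed.

Definition S_group : lie_group R 7 :=
  LieGroup S_mulA S_mul1 S_mulV S_mul_smooth S_inv_smooth.

Lemma coframe_linear x : linear (coframe m x).
Proof.
move=> a u v; apply: dx_ext => k kn; rewrite dxD dxZ /coframe !dx_list //.
by case: k kn => [|[|[|[|[|[|[|k]]]]]]] //= _; rewrite /eta2 /eta3 !dxD !dxZ; ring.
Qed.

Lemma coframe_inj x : m != 0 -> injective (coframe m x).
Proof.
move=> m0 u v E.
have {}E k : (k < 7)%N -> dx k.+1 (coframe m x u) = dx k.+1 (coframe m x v).
  by rewrite E.
have eN0 z : expR z != 0 :> R by rewrite gt_eqF ?expR_gt0.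
have c0 z : - (3 / 5) * m * expR z != 0.
  rewrite !mulf_neq0 // oppr_eq0 mulf_neq0 ?invr_eq0 ?pnatr_eq0 //.
have := (E 0 isT, E 1 isT, E 2 isT, E 3 isT, E 4 isT, E 5 isT, E 6 isT)%N.
rewrite /coframe !dx_list //= => -[[[[[[/(mulfI (eN0 _)) e1 /(mulfI (c0 _)) e2]
  /(mulfI (c0 _)) e3] /(mulfI (eN0 _)) e4] /(mulfI (eN0 _)) e5]
  /(mulfI (eN0 _)) e6] e7].
rewrite /eta2 e5 in e2; rewrite /eta3 e5 e6 in e3.
have {}e2 := addIr _ e2; have {}e3 := addIr _ (addIr _ e3).
by apply: dx_ext => k kn; case: k kn => [|[|[|[|[|[|[|k]]]]]]] //= _.
Qed.

Lemma coframe_smooth u i : smooth (fun x => coframe m x u 0 i).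
Proof.
move: i; apply: smooth_row => k kn; rewrite /coframe.
under eq_fun do rewrite dx_list //.
by case: k kn => [|[|[|[|[|[|[|k]]]]]]] //= _; rewrite /eta2 /eta3; smooth_tac.
Qed.

Lemma is_derive_dx k x u : is_derive x u (dx k : 'rV[R]_7 -> R) (dx k u).
Proof. by apply: is_derive_lin; exact: dx_linear. Qed.

Lemma derive_dx (f : 'rV[R]_7 -> 'rV[R]_7) x u k :
  (forall i, (i < 7)%N -> derivable (fun y => dx i.+1 (f y)) x u) ->
  dx k ('D_u f x) = 'D_u (fun y => dx k (f y)) x.
Proof.
move=> H; rewrite derive_mx ?/dx ?mxE //.
by apply/derivable_mxP => i j; have := H j (ltn_ord j); rewrite /dx /= inord_val ord1.
Qed.

Lemma is_derive_opp (f : 'rV[R]_7 -> R) x u (d : R) :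
  is_derive x u f d -> is_derive x u (fun y => - f y) (- d).
Proof. by move=> ?; exact: is_deriveN. Qed.

Lemma is_derive_const (c : R) x u : is_derive x u (fun=> c) 0.
Proof. exact: (is_derive_cst c). Qed.

Lemma S_mul_linear a : linear (fun u => S_mul a u - a).
Proof.
move=> r u v; apply: dx_ext => k kn.
rewrite dxB [RHS]dxD dxZ !dxB /S_mul !dx_list //.
by case: k kn => [|[|[|[|[|[|[|k]]]]]]] //= _; rewrite !dxD !dxZ; ring.
Qed.

Lemma S_mul_derive a x u : 'D_u (S_mul a) x = S_mul a u - a.
Proof.
have H i : is_derive x u (fun y => S_mul a y 0 i) ((S_mul a u - a) 0 i).
  have := @is_derive_lin _ _ (fun y => (S_mul a y - a) 0 i) x u.
  have l : linear (fun y => (S_mul a y - a) 0 i : R^o).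
    by move=> r v w; rewrite S_mul_linear !mxE.
  move=> /(_ l) d; have := is_derive_add d (is_derive_cst (a 0 i) x u).
  by rewrite addr0 (_ : (fun y => _ + _) = fun y => S_mul a y 0 i) //;
    apply/funext => y; rewrite !mxE subrK.
rewrite derive_mx; last first.
  by apply/derivable_mxP => i j; rewrite ord1; exact: (@ex_derive _ _ _ _ _ _ _ (H j)).
by apply/rowP => j; rewrite mxE (@derive_val _ _ _ _ _ _ _ (H j)).
Qed.

Lemma coframe_left_invariant a x u :
  coframe m (S_mul a x) ('D_u (S_mul a) x) = coframe m x u.
Proof.
rewrite S_mul_derive; apply: dx_ext => k kn.
have E r : expR (r * m * (dx 7 a + dx 7 x))
         = expR (r * m * dx 7 a) * expR (r * m * dx 7 x).
  by rewrite -expRD; congr expR; ring.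
set p := expR (5^-1 * m * dx 7 a).
have p0 : p != 0 by rewrite gt_eqF ?expR_gt0.
have P (j : nat) : expR (j%:R / 5 * m * dx 7 a) = p ^+ j.
  by rewrite /p -expRM_natl; congr expR; ring.
have Q (j : nat) : expR (- (j%:R / 5) * m * dx 7 a) = p ^- j.
  by rewrite -P -expRN; congr expR; ring.
rewrite /coframe !dx_list //.
case: k kn => [|[|[|[|[|[|[|k]]]]]]] //= _; rewrite /eta2 /eta3 !dxB /S_mul !dx_list //=
  ?E ?P ?Q; by field.
Qed.

Lemma is_derive_val (f : 'rV[R]_7 -> R) x u (d e : R) :
  is_derive x u f d -> d = e -> is_derive x u f e.
Proof. by move=> ? <-. Qed.

Lemma is_derive_coframe x u v k : (k < 7)%N ->
  is_derive x u (fun y => dx k.+1 (coframe m y v))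
    (let t := dx 7 x in
     [:: (4 / 5) * m * dx 7 u * (expR ((4 / 5) * m * t) * dx 1 v);
         - (3 / 5) * m * expR ((6 / 5) * m * t)
           * ((6 / 5) * m * dx 7 u * eta2 x v + (2 / 3) * dx 4 u * dx 5 v);
         - (3 / 5) * m * expR ((7 / 5) * m * t)
           * ((7 / 5) * m * dx 7 u * eta3 x v - (2 / 3) * dx 1 u * dx 5 v
              + (2 / 3) * dx 4 u * dx 6 v);
         (3 / 5) * m * dx 7 u * (expR ((3 / 5) * m * t) * dx 4 v);
         (3 / 5) * m * dx 7 u * (expR ((3 / 5) * m * t) * dx 5 v);
         (4 / 5) * m * dx 7 u * (expR ((4 / 5) * m * t) * dx 6 v);
         0]`_k).
Proof.
move=> kn; rewrite /coframe; under eq_fun do rewrite dx_list //.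
have dc (c : R) : is_derive x u (fun=> c) 0 := is_derive_const c x u.
have dX i : is_derive x u (dx i) (dx i u) := is_derive_dx i x u.
have dE (q : R) : is_derive x u (fun y => expR (q * m * dx 7 y))
    (expR (q * m * dx 7 x) * (q * m * dx 7 u)).
  apply: is_derive_val (is_derive_exp (is_derive_mul (dc (q * m)) (dX 7))) _.
  by rewrite mulr0 addr0.
have dL i (q r : R) : is_derive x u (fun y => q * dx i y * r) (q * dx i u * r).
  apply: is_derive_val (is_derive_mul (is_derive_mul (dc q) (dX i)) (dc r)) _.
  by ring.
have d2 := is_derive_add (dc (dx 2 v)) (dL 4 (2 / 3) (dx 5 v)).
have d3 := is_derive_add (is_derive_add (dc (dx 3 v))
  (is_derive_opp (dL 1 (2 / 3) (dx 5 v)))) (dL 4 (2 / 3) (dx 6 v)).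
case: k kn => [|[|[|[|[|[|[|k]]]]]]] //= _; rewrite /eta2 /eta3.
- by apply: is_derive_val (is_derive_mul (dE _) (dc _)) _; ring.
- by apply: is_derive_val (is_derive_mul (is_derive_mul (dc _) (dE _)) d2) _; ring.
- by apply: is_derive_val (is_derive_mul (is_derive_mul (dc _) (dE _)) d3) _; ring.
- by apply: is_derive_val (is_derive_mul (dE _) (dc _)) _; ring.
- by apply: is_derive_val (is_derive_mul (dE _) (dc _)) _; ring.
- by apply: is_derive_val (is_derive_mul (dE _) (dc _)) _; ring.
Qed.

Lemma coframe_structure x u v i :
  ext_d (fun y w => coframe m y w 0 i) x u v
  = - s_bracket m (coframe m x u) (coframe m x v) 0 i.
Proof.
have D w w' k : (k < 7)%N -> _ := fun kn =>
  @derive_val _ _ _ _ _ _ _ (@is_derive_coframe x w w' k kn).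
rewrite /s_bracket mxE opprK /ext_d -[i]inord_val.
rewrite -[X in X - _]/('D_u (fun y => dx i.+1 (coframe m y v)) x).
rewrite -[X in _ - X]/('D_v (fun y => dx i.+1 (coframe m y u)) x).
rewrite !D ?ltn_ord // -[RHS]/(dx i.+1 (s_de m _ _)) /s_de dx_list ?ltn_ord //.
have E p q r : p = q + r -> expR (p * m * dx 7 x)
    = expR (q * m * dx 7 x) * expR (r * m * dx 7 x).
  by move=> ->; rewrite -expRD; congr expR; ring.
have E2 : expR (6 / 5 * m * dx 7 x) = expR (3 / 5 * m * dx 7 x) ^+ 2.
  by rewrite expr2 -expRD; congr expR; field.
have E3 : expR (7 / 5 * m * dx 7 x)
    = expR (3 / 5 * m * dx 7 x) * expR (4 / 5 * m * dx 7 x).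
  by rewrite -expRD; congr expR; field.
have := ltn_ord i; move: (i : nat) => k.
by case: k => [|[|[|[|[|[|[|k]]]]]]] //= _; rewrite /wedge2 /coframe ?dx_list //=
  ?E2 ?E3 /eta2 /eta3; field.
Qed.

Lemma s_extends_n : m != 0 -> extends_n m.
Proof.
move=> m0; set c := - (2 / 5) * m.
have c0 : c != 0 by rewrite mulf_neq0 // oppr_eq0 mulf_neq0 ?invr_eq0 ?pnatr_eq0.
pose f (X : 'rV[R]_6) : 'rV[R]_7 :=
  \row_i [:: dx 1 X; c * dx 2 X; c * dx 3 X; dx 4 X; dx 5 X; dx 6 X; 0]`_i.
exists f; split.
- move=> a u v; apply: dx_ext => k kn; rewrite dxD dxZ /f !dx_list //.
  by case: k kn => [|[|[|[|[|[|[|k]]]]]]] //= _; rewrite ?dxD ?dxZ; ring.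
- move=> u v E.
  have {}E k : (k < 7)%N -> dx k.+1 (f u) = dx k.+1 (f v) by rewrite E.
  have := (E 0 isT, E 1 isT, E 2 isT, E 3 isT, E 4 isT, E 5 isT)%N.
  rewrite /f !dx_list //= => -[[[[[e1 /(mulfI c0) e2] /(mulfI c0) e3] e4] e5] e6].
  by apply: dx_ext => k kn; case: k kn => [|[|[|[|[|[|k]]]]]] //= _.
- apply/seteqP; split=> [X [Y _ <-]|X /= X7]; first by rewrite /f /= dx_list.
  exists (\row_i [:: dx 1 X; c^-1 * dx 2 X; c^-1 * dx 3 X; dx 4 X; dx 5 X; dx 6 X]`_i).
    by [].
  apply: dx_ext => k kn; rewrite /f !dx_list //.
  by case: k kn => [|[|[|[|[|[|[|k]]]]]]] //= _;
    rewrite ?(@dx_row _ 5 _ (nth 0 _)) //= ?mulVKf // X7.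
- move=> X Y; apply: dx_ext => k kn; rewrite /s_bracket dxN /s_de /f !dx_list //.
  by case: k kn => [|[|[|[|[|[|[|k]]]]]]] //= _;
    rewrite /wedge2 ?dx_list //= /n_bracket ?(@dx_row _ 5 _ (nth 0 _)) //= /wedge2 /c; field.
Qed.

Lemma solvable_group_S_exists : m != 0 -> exists S, solvable_group_S m S.
Proof.
move=> m0; exists S_group; split; first exact: s_extends_n.
split.
- by move=> x; split; [exact: coframe_linear|exact: coframe_inj].
- exact: coframe_smooth.
- exact: coframe_left_invariant.
- exact: coframe_structure.
Qed.

End Existence.

(* Main.v *)
(* Write the metric as the sum of squares of the orthonormal coframe
   e^{-mt} (e^7, -e^2, e^3, e^1, e^4, e^5, e^6), called [eps]. By Cartan's
   structure equations its connection form is (m/5) times the sum of e^i L_i,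
   i = 1, ..., 6, with constant matrices L_i in g_2, so [phi0] read in this
   coframe is parallel and the holonomy is contained in G_2.

   For the converse no Ambrose-Singer theorem is needed. Transport along a
   straight line in a left-invariant direction e_i of the nilpotent part is a
   rotation exp(-s L_i) whose angle depends exponentially on the level t, and
   transport in the direction of t is trivial; hence rectangles in the plane of
   e_i and e_7 have holonomy exp(s L_i) for every real s. These one-parameter
   groups generate G_2: their conjugates contain enough copies of SU(2), each
   acting on four coordinates, to move any element of G_2 successively into the
   stabilizers of e_1, of e_1 and e_2, and of e_1, e_2 and e_4, which is trivial.
   This also needs that G_2, defined as the stabilizer of [phi0] only, preserves
   the scalar product. *)
From HB Require Import structures.
Require Import Defs.
From mathcomp Require Import all_boot all_order all_algebra.
From mathcomp Require Import all_classical all_reals all_analysis.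
From mathcomp Require Import ring lra.
Import Order.TTheory GRing.Theory Num.Theory.
Import numFieldNormedType.Exports.
Local Open Scope ring_scope.

Set Implicit Arguments.
Unset Strict Implicit.
Unset Printing Implicit Defensive.

(** * Rotations generating G2 *)

Section Rotations.
Context {R : realType}.
Implicit Types (u v w : 'rV[R]_7) (A B M : 'M[R]_7) (t : R).

(** [acos] only yields angles between 0 and [pi], so the sign of [y] decides between that angle and
    its opposite. *)
Lemma polar (x y : R) : exists r t, [/\ 0 <= r, x = r * cos t & y = r * sin t].
Proof.
set n := x ^+ 2 + y ^+ 2.
have [n0|n0] := eqVneq n 0.
  exists 0, 0; rewrite !mul0r; split => //; apply/eqP; rewrite -sqrf_eq0.
    by move/eqP: n0; rewrite paddr_eq0 ?sqr_ge0 // => /andP[].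
  by move/eqP: n0; rewrite paddr_eq0 ?sqr_ge0 // => /andP[].
have {}n0 : 0 < n by rewrite lt_def n0 addr_ge0 ?sqr_ge0.
pose r := Num.sqrt n; have r0 : 0 < r by rewrite sqrtr_gt0.
have rN0 : r != 0 by rewrite gt_eqF.
have r2 : r ^+ 2 = n by rewrite sqr_sqrtr // ltW.
have xr : -1 <= x / r <= 1.
  rewrite ler_pdivlMr // ler_pdivrMr // mulN1r mul1r -ler_norml.
  by rewrite -sqrtr_sqr ler_wsqrtr // lerDl sqr_ge0.
have s : sin (acos (x / r)) = `|y| / r.
  rewrite sin_acos // -[RHS]ger0_norm ?divr_ge0 ?(ltW r0) // -sqrtr_sqr.
  rewrite !exprMn exprVn r2 real_normK ?num_real //; congr Num.sqrt.
  by rewrite /n; field; rewrite gt_eqF.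
have [y0|y0] := leP 0 y.
  exists r, (acos (x / r)); rewrite acosK // s ger0_norm //.
  by split; [exact: ltW|field|field].
exists r, (- acos (x / r)); rewrite cosN sinN acosK // s ltr0_norm //.
by split; [exact: ltW|field|field].
Qed.

(** Multiplication of the complex numbers with parts ([f a], [f b]) and ([f c], [f d]) by
    [co + i si]. Free [co] and [si] turn identities between rotations into polynomial ones. *)
Definition rot_coord (a b c d : nat) (co si : R) (f : nat -> R) (k : nat) : R :=
  if k == a then f a * co - f b * si
  else if k == b then f b * co + f a * si
  else if k == c then f c * co - f d * si
  else if k == d then f d * co + f c * si
  else f k.

Definition rot_row a b c d t u : 'rV[R]_7 :=
  \row_i rot_coord a b c d (cos t) (sin t) (fun l => dx l u) i.+1.

Lemma rot_row_linear a b c d t : linear (rot_row a b c d t).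
Proof.
by move=> r u v; apply/rowP => i; rewrite !mxE /rot_coord !dxD !dxZ; do 4?[case: ifP => _]; ring.
Qed.

HB.instance Definition _ a b c d t :=
  GRing.isLinear.Build R 'rV[R]_7 'rV[R]_7 *:%R (rot_row a b c d t)
    (@rot_row_linear a b c d t).

(* Locked, since otherwise comparing two rotations unfolds matrix products. *)
Definition rotm a b c d t : 'M[R]_7 := locked (lin1_mx (rot_row a b c d t)).

Lemma dx_rot a b c d t u k : (0 < k < 8)%N ->
  dx k (u *m rotm a b c d t) = rot_coord a b c d (cos t) (sin t) (fun l => dx l u) k.
Proof.
by case: k => // k k7; rewrite /rotm -lock mul_rV_lin1 {1}/dx mxE inordK.
Qed.

Lemma coord_ind (P : nat -> Prop) : P 1%N -> P 2%N -> P 3%N -> P 4%N -> P 5%N -> P 6%N ->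
  P 7%N -> forall k, (0 < k < 8)%N -> P k.
Proof. by move=> ? ? ? ? ? ? ?; do 8?case=> //. Qed.

Lemma dx_ext7 u v : dx 1 u = dx 1 v -> dx 2 u = dx 2 v -> dx 3 u = dx 3 v ->
  dx 4 u = dx 4 v -> dx 5 u = dx 5 v -> dx 6 u = dx 6 v -> dx 7 u = dx 7 v -> u = v.
Proof.
by move=> *; apply: dx_ext => k; case: k => [|[|[|[|[|[|[|k]]]]]]].
Qed.

Lemma mx_act_ext A B : (forall u, u *m A = u *m B) -> A = B.
Proof. by move=> E; apply/row_matrixP => i; rewrite !rowE. Qed.

Definition plane_pair (a b c d : nat) : bool :=
  uniq [:: a; b; c; d] && all (fun k => 0 < k < 8)%N [:: a; b; c; d].

Lemma plane_pair_rot a b c d : plane_pair a b c d -> plane_pair a c d b.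
Proof.
have P : perm_eq [:: a; c; d; b] [:: a; b; c; d] by rewrite perm_cons (perm_rot 1 [:: b; c; d]).
by rewrite /plane_pair (perm_uniq P) (perm_all _ P).
Qed.

Lemma dx_rotP a b c d t u : plane_pair a b c d ->
  [/\ dx a (u *m rotm a b c d t) = dx a u * cos t - dx b u * sin t,
      dx b (u *m rotm a b c d t) = dx b u * cos t + dx a u * sin t,
      dx c (u *m rotm a b c d t) = dx c u * cos t - dx d u * sin t &
      dx d (u *m rotm a b c d t) = dx d u * cos t + dx c u * sin t].
Proof.
rewrite /plane_pair /= !inE !negb_or => /andP[/andP[/and3P[ab ac ad]]].
move=> /andP[/andP[bc bd] /andP[cd _]] /and5P[ha hb hc hd _].
rewrite !dx_rot // /rot_coord !eqxx (eq_sym b a) (eq_sym c a) (eq_sym d a) (eq_sym c b).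
by rewrite (eq_sym d b) (eq_sym d c) !ifN.
Qed.

Lemma dx_rot_out a b c d t u k : (0 < k < 8)%N -> k \notin [:: a; b; c; d] ->
  dx k (u *m rotm a b c d t) = dx k u.
Proof.
by move=> hk; rewrite !inE !negb_or => /and4P[? ? ? ?];
  rewrite dx_rot // /rot_coord !ifN.
Qed.

Lemma rot_fix a b c d t u : dx a u = 0 -> dx b u = 0 -> dx c u = 0 -> dx d u = 0 ->
  u *m rotm a b c d t = u.
Proof.
move=> a0 b0 c0 d0; apply: dx_ext => k k7; rewrite dx_rot // /rot_coord.
by do 4![case: eqVneq => [->|_]; first by rewrite ?(a0, b0, c0, d0) !mul0r ?subr0 ?addr0].
Qed.

Lemma rotm_add a b c d s t : plane_pair a b c d ->
  rotm a b c d s *m rotm a b c d t = rotm a b c d (s + t).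
Proof.
move=> P; apply: mx_act_ext => u; rewrite mulmxA.
have [A1 B1 C1 D1] := dx_rotP s u P.
have [A2 B2 C2 D2] := dx_rotP t (u *m rotm a b c d s) P.
have [A3 B3 C3 D3] := dx_rotP (s + t) u P.
rewrite {}A1 {}B1 {}C1 {}D1 in A2 B2 C2 D2; rewrite cosD sinD in A3 B3 C3 D3.
apply: dx_ext => k k7; have [|kN] := boolP (k.+1 \in [:: a; b; c; d]).
  by rewrite !inE => /or4P[] /eqP ->; rewrite ?(A2, B2, C2, D2) ?(A3, B3, C3, D3); ring.
by rewrite !dx_rot_out.
Qed.

Lemma rotm0 a b c d : rotm a b c d 0 = 1%:M.
Proof.
apply: mx_act_ext => u; apply: dx_ext => k k7.
rewrite dx_rot // /rot_coord cos0 sin0 !mulr1 !mulr0 !subr0 !addr0 mulmx1.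
by do 4![case: eqVneq => [->|_] //].
Qed.

Lemma rotV a b c d t : plane_pair a b c d -> rotm a b c d t *m rotm a b c d (- t) = 1%:M.
Proof. by move=> P; rewrite rotm_add // subrr rotm0. Qed.

(* The one-parameter groups exp(-t L_i) for i = 1, 2, 6 and 3. *)
Inductive rot_gen : 'M[R]_7 -> Prop :=
| rot_gen1 t : rot_gen (rotm 1 4 6 3 t)
| rot_gen2 t : rot_gen (rotm 1 2 5 6 t)
| rot_gen6 t : rot_gen (rotm 1 7 5 3 t)
| rot_gen3 t : rot_gen (rotm 3 1 6 4 t *m rotm 3 1 5 7 t)
| rot_genM A B : rot_gen A -> rot_gen B -> rot_gen (A *m B).

(* Phrasing matrix products by maps of coordinates (numbered from 1 to 7) keeps
   the vectors abstract in explicit computations. *)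
Definition acts A (F : (nat -> R) -> nat -> R) :=
  [/\ forall u k, (0 < k < 8)%N -> dx k (u *m A) = F (fun l => dx l u) k &
      forall f g, (forall k, (0 < k < 8)%N -> f k = g k) ->
        forall k, (0 < k < 8)%N -> F f k = F g k].

(** [A] acts first on row vectors. The second clause of [acts] enters here: only coordinates 1 to 7
    of the intermediate vector are known. *)
Lemma acts_mul A B F G : acts A F -> acts B G -> acts (A *m B) (fun f => G (F f)).
Proof.
move=> [AF FF] [BG GG]; split=> [u k hk|f g fg]; last by apply: GG; exact: FF.
by rewrite mulmxA BG //; apply: GG => // l hl; exact: AF.
Qed.

Lemma acts_eq A B F G : acts A F -> acts B G ->
  (forall f k, (0 < k < 8)%N -> F f k = G f k) -> A = B.
Proof.
move=> [AF _] [BG _] FG; apply: mx_act_ext => u; apply: dx_ext => k k7.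
by rewrite AF // FG // BG.
Qed.

Lemma acts_rot a b c d t : plane_pair a b c d ->
  acts (rotm a b c d t) (rot_coord a b c d (cos t) (sin t)).
Proof.
move=> /andP[_ /and5P[ha hb hc hd _]]; split=> [u k hk|f g fg k hk].
  exact: dx_rot.
by rewrite /rot_coord !fg.
Qed.

(** Both rotations turn the plane of coordinates 3 and 1, where the angles add up; their other
    planes are disjoint. *)
Lemma rotm_comm3 s t : rotm 3 1 5 7 s *m rotm 3 1 6 4 t = rotm 3 1 6 4 t *m rotm 3 1 5 7 s.
Proof.
apply: acts_eq (acts_mul (acts_rot _ _) (acts_rot _ _))
  (acts_mul (acts_rot _ _) (acts_rot _ _)) _ => // f.
by apply: coord_ind; rewrite /rot_coord /=; ring.
Qed.

Lemma rot_genV A : rot_gen A -> exists B, [/\ rot_gen B, A *m B = 1%:M & B *m A = 1%:M].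
Proof.
have V A1 B1 : A1 *m B1 = 1%:M -> B1 *m A1 = 1%:M by exact: mulmx1C.
suff H : rot_gen A -> exists2 B, rot_gen B & A *m B = 1%:M.
  by move=> /H[B gB AB]; exists B; split=> //; exact: V.
elim=> [t|t|t|t|A1 A2 _ [B1 g1 E1] _ [B2 g2 E2]].
- by exists (rotm 1 4 6 3 (- t)); [exact: rot_gen1|exact: rotV].
- by exists (rotm 1 2 5 6 (- t)); [exact: rot_gen2|exact: rotV].
- by exists (rotm 1 7 5 3 (- t)); [exact: rot_gen6|exact: rotV].
(* As the two factors commute, the inverse has the shape of a generator again. *)
- exists (rotm 3 1 6 4 (- t) *m rotm 3 1 5 7 (- t)); first exact: rot_gen3.
  rewrite -(rotm_comm3 (- t) (- t)).
  by rewrite !mulmxA -[X in X *m _]mulmxA rotV // mulmx1 rotV.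
- exists (B2 *m B1); first exact: rot_genM.
  by rewrite mulmxA -[X in X *m _]mulmxA E2 mulmx1.
Qed.

(** * Conjugate circles and the reduction of vectors *)

Definition circle_in (a b c d : nat) := forall t, rot_gen (rotm a b c d t).

(** Conjugation by [P] carries one circle to the other; [n] tells whether the sense of rotation is
    reversed. *)
Lemma circle_conj (n : bool) (a b c d a' b' c' d' : nat) P F :
  rot_gen P -> acts P F -> plane_pair a b c d -> plane_pair a' b' c' d' ->
  (forall co si f k, (0 < k < 8)%N ->
     F (rot_coord a b c d co (if n then - si else si) f) k
     = rot_coord a' b' c' d' co si (F f) k) ->
  circle_in a b c d -> circle_in a' b' c' d'.
Proof.
move=> gP aP p p' E C t; have [Q [gQ PQ QP]] := rot_genV gP.
pose t' := if n then - t else t.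
rewrite -[rotm _ _ _ _ t]mul1mx -QP -mulmxA.
have <- : rotm a b c d t' *m P = P *m rotm a' b' c' d' t.
  apply: acts_eq (acts_mul (acts_rot t' p) aP) (acts_mul aP (acts_rot t p')) _ => f k.
  have := E (cos t) (sin t) f k.
  by rewrite /t'; case: n {E t'} => //; rewrite cosN sinN.
by apply: rot_genM => //; apply: rot_genM.
Qed.

(* The generators at angle [pi / 2] permute the coordinate axes up to sign, so
   conjugation by them turns rotations into rotations of other planes. *)
Let g1 := rot_gen1 (pi / 2).
Let g2 := rot_gen2 (pi / 2).
Let g6 := rot_gen6 (pi / 2).
Let g3 := rot_gen3 (pi / 2).
Let a1 := @acts_rot 1 4 6 3 (pi / 2) isT.
Let a2 := @acts_rot 1 2 5 6 (pi / 2) isT.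
Let a6 := @acts_rot 1 7 5 3 (pi / 2) isT.
Let a3 := acts_mul (@acts_rot 3 1 6 4 (pi / 2) isT) (@acts_rot 3 1 5 7 (pi / 2) isT).

Ltac conj_tac := move=> co si f; apply: coord_ind;
  rewrite /rot_coord /= ?cos_pihalf ?sin_pihalf; ring.

(** With the generators 1 4 6 3 and 1 7 5 3, the circles from here on give the pairs [a b c d],
    [a c d b] required by [kill] on the coordinate sets 1247, 1463, 1753, 4765 and 2543, one copy of
    SU(2) for each. [circle_4576] is only an intermediate conjugate. *)
Lemma circle_1634 : circle_in 1 6 3 4.
Proof. by apply: (@circle_conj false _ _ _ _ _ _ _ _ _ _ g3 a3 _ _ _ rot_gen1);
  [by []|by []|conj_tac]. Qed.

Lemma circle_1247 : circle_in 1 2 4 7.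
Proof. by apply: (@circle_conj true _ _ _ _ _ _ _ _ _ _ g3 a3 _ _ _ rot_gen2);
  [by []|by []|conj_tac]. Qed.

Lemma circle_1537 : circle_in 1 5 3 7.
Proof. by apply: (@circle_conj false _ _ _ _ _ _ _ _ _ _ g3 a3 _ _ _ rot_gen6);
  [by []|by []|conj_tac]. Qed.

Lemma circle_2435 : circle_in 2 4 3 5.
Proof. by apply: (@circle_conj false _ _ _ _ _ _ _ _ _ _ g2 a2 _ _ _ rot_gen1);
  [by []|by []|conj_tac]. Qed.

Lemma circle_4765 : circle_in 4 7 6 5.
Proof. by apply: (@circle_conj true _ _ _ _ _ _ _ _ _ _ g6 a6 _ _ _ rot_gen1);
  [by []|by []|conj_tac]. Qed.

Lemma circle_2543 : circle_in 2 5 4 3.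
Proof. by apply: (@circle_conj true _ _ _ _ _ _ _ _ _ _ g2 a2 _ _ _ circle_1634);
  [by []|by []|conj_tac]. Qed.

Lemma circle_4576 : circle_in 4 5 7 6.
Proof. by apply: (@circle_conj false _ _ _ _ _ _ _ _ _ _ g6 a6 _ _ _ circle_1634);
  [by []|by []|conj_tac]. Qed.

Lemma circle_1472 : circle_in 1 4 7 2.
Proof. by apply: (@circle_conj false _ _ _ _ _ _ _ _ _ _ g6 a6 _ _ _ circle_1247);
  [by []|by []|conj_tac]. Qed.

Lemma circle_4657 : circle_in 4 6 5 7.
Proof. by apply: (@circle_conj false _ _ _ _ _ _ _ _ _ _ g2 a2 _ _ _ circle_4576);
  [by []|by []|conj_tac]. Qed.

(* With [z = a + i b] and [w = c + i d], the first circle multiplies z and w by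
   a phase and can give them opposite phases; the second one then kills w, and
   the first one makes z real. *)
Lemma kill a b c d v : plane_pair a b c d -> circle_in a b c d -> circle_in a c d b ->
  exists2 h, rot_gen h &
    [/\ 0 <= dx a (v *m h),
        [/\ dx b (v *m h) = 0, dx c (v *m h) = 0 & dx d (v *m h) = 0],
        forall k, (0 < k < 8)%N -> k \notin [:: a; b; c; d] -> dx k (v *m h) = dx k v &
        forall u, dx a u = 0 -> dx b u = 0 -> dx c u = 0 -> dx d u = 0 -> u *m h = u].
Proof.
move=> P C1 C2; have P2 := plane_pair_rot P.
have [r [x [r0 ra rb]]] := polar (dx a v) (dx b v).
have [q [y [q0 qc qd]]] := polar (dx c v) (dx d v).
(* For opposite phases -e and e, the pair (a, c) is [cos e] times (r, q) and (d, b) is [sin e] times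
   (q, -r), so a single angle [z] kills both c and d. *)
have [p [z [p0 pr pq]]] := polar r q.
set e := (y - x) / 2.
exists (rotm a b c d (- ((x + y) / 2)) *m rotm a c d b (- z) *m rotm a b c d e).
  by apply: rot_genM => //; apply: rot_genM.
set v1 := v *m rotm a b c d (- ((x + y) / 2)).
set v2 := v1 *m rotm a c d b (- z).
set v3 := v2 *m rotm a b c d e.
have -> : v *m (rotm a b c d (- ((x + y) / 2)) *m rotm a c d b (- z) *m rotm a b c d e) = v3.
  by rewrite !mulmxA.
have [A1 B1 C1' D1] := dx_rotP (- ((x + y) / 2)) v P.
have [A2 C2' D2 B2] := dx_rotP (- z) v1 P2.
have [A3 B3 C3' D3] := dx_rotP e v2 P.
have ex : x + - ((x + y) / 2) = - e by rewrite /e; field.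
have ey : y + - ((x + y) / 2) = e by rewrite /e; field.
have {}A1 : dx a v1 = r * cos e by rewrite A1 ra rb -(cosN e) -ex cosD; ring.
have {}B1 : dx b v1 = - (r * sin e).
  by rewrite B1 ra rb -(mulrN r) -(sinN e) -ex sinD; ring.
have {}C1' : dx c v1 = q * cos e by rewrite C1' qc qd -ey cosD; ring.
have {}D1 : dx d v1 = q * sin e by rewrite D1 qc qd -ey sinD; ring.
rewrite -/v1 -/v2 -/v3 A1 B1 C1' D1 cosN sinN pr pq in A2 B2 C2' D2 A3 B3 C3' D3.
have cs (t x1 : R) : x1 = x1 * (cos t ^+ 2 + sin t ^+ 2) by rewrite cos2Dsin2 mulr1.
have {}A2 : dx a v2 = p * cos e by rewrite A2 [RHS](cs z); ring.
have {}B2 : dx b v2 = - (p * sin e) by rewrite B2 [RHS](cs z); ring.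
have {}C2' : dx c v2 = 0 by rewrite C2'; ring.
have {}D2 : dx d v2 = 0 by rewrite D2; ring.
rewrite A2 B2 C2' D2 in A3 B3 C3' D3.
split.
- by rewrite A3 (_ : _ - _ = p) // [RHS](cs e); ring.
- by split; [rewrite B3|rewrite C3'|rewrite D3]; ring.
- move=> k hk kN; rewrite /v3 dx_rot_out // /v2 dx_rot_out //; last first.
    by move: kN; rewrite !inE !negb_or => /and4P[-> -> -> ->].
  by rewrite /v1 dx_rot_out.
- by move=> u ua ub uc ud; rewrite !mulmxA !rot_fix.
Qed.

End Rotations.

(** * The stabilizer of the 3-form *)

Section Stabilizer.
Context {R : realType}.
Implicit Types (u v w : 'rV[R]_7) (A B M N : 'M[R]_7).

Definition dot u v : R := \sum_(k < 7) u 0 k * v 0 k.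

Lemma dotE u v : dot u v = dx 1 u * dx 1 v + dx 2 u * dx 2 v + dx 3 u * dx 3 v
  + dx 4 u * dx 4 v + dx 5 u * dx 5 v + dx 6 u * dx 6 v + dx 7 u * dx 7 v.
Proof.
have E (k : 'I_7) : u 0 k * v 0 k = dx k.+1 u * dx k.+1 v by rewrite /dx inord_val.
by rewrite /dot; under eq_bigr do rewrite E; rewrite 7!big_ord_recr big_ord0 /= add0r.
Qed.

Lemma dot_mx u v : dot u v = (u *m v^T) 0 0.
Proof. by rewrite mxE; apply: eq_bigr => k _; rewrite mxE. Qed.

Lemma form_ext A B : (forall u v, (u *m A *m v^T) 0 0 = (u *m B *m v^T) 0 0) -> A = B.
Proof.
move=> E; apply/matrixP => i j; have := E 'e_i 'e_j.
by rewrite -!rowE trmx_delta -!colE !mxE.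
Qed.

Definition preserves_dot A := forall u v, dot (u *m A) (v *m A) = dot u v.
Definition preserves_phi A := forall u v w, phi0 (u *m A) (v *m A) (w *m A) = phi0 u v w.

Lemma preserves_dot_mx A : preserves_dot A -> A *m A^T = 1%:M.
Proof.
move=> H; apply: form_ext => u v; rewrite mulmx1; have := H u v; rewrite !dot_mx => <-.
by rewrite trmx_mul !mulmxA.
Qed.

Lemma preserves_dot_det A : preserves_dot A -> \det A ^+ 2 = 1.
Proof. by move=> /preserves_dot_mx/(congr1 determinant); rewrite det_mulmx det_tr det1. Qed.

Lemma preserves_dotM A B : preserves_dot A -> preserves_dot B -> preserves_dot (A *m B).
Proof. by move=> HA HB u v; rewrite !mulmxA HB HA. Qed.

Lemma preserves_phiM A B : preserves_phi A -> preserves_phi B -> preserves_phi (A *m B).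
Proof. by move=> HA HB u v w; rewrite !mulmxA HB HA. Qed.

Definition ev (k : nat) : 'rV[R]_7 := \row_i (i.+1 == k)%:R.

Lemma dx_ev k l : (0 < k < 8)%N -> dx k (ev l) = (k == l)%:R.
Proof. by case: k => // k k7; rewrite /dx mxE inordK. Qed.

Ltac phi_ev := rewrite /phi0 /wedge3 /wedge2 ?dx_ev //=; ring.

Definition omega1 u v : R := wedge2 (dx 2) (dx 3) u v + wedge2 (dx 4) (dx 5) u v
  + wedge2 (dx 6) (dx 7) u v.

Lemma phi0_ev1 u v : phi0 (ev 1) u v = omega1 u v.
Proof. rewrite /omega1; phi_ev. Qed.

Lemma phi0_ev12 w : phi0 (ev 1) (ev 2) w = dx 3 w.
Proof. phi_ev. Qed.

Lemma phi0_ev14 w : phi0 (ev 1) (ev 4) w = dx 5 w.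
Proof. phi_ev. Qed.

Lemma phi0_ev24 w : phi0 (ev 2) (ev 4) w = dx 6 w.
Proof. phi_ev. Qed.

Lemma phi0_ev16 w : phi0 (ev 1) (ev 6) w = dx 7 w.
Proof. phi_ev. Qed.

Lemma phi0Z1 (r : R) u v w : phi0 (r *: u) v w = r * phi0 u v w.
Proof. by rewrite /phi0 /wedge3 /wedge2 !dxZ; ring. Qed.

Lemma dot_ev u k : (0 < k < 8)%N -> dot u (ev k) = dx k u.
Proof.
move: k; apply: coord_ind; rewrite dotE ?dx_ev //=; ring.
Qed.

Lemma dotZ (r : R) u v : dot (r *: u) v = r * dot u v.
Proof. by rewrite !dotE !dxZ; ring. Qed.

Lemma dotZr (r : R) u v : dot u (r *: v) = r * dot u v.
Proof. by rewrite !dotE !dxZ; ring. Qed.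

Lemma dotC u v : dot u v = dot v u.
Proof. by apply: eq_bigr => k _; rewrite mulrC. Qed.

Lemma dotDl u v w : dot (u + v) w = dot u w + dot v w.
Proof. by rewrite -big_split; apply: eq_bigr => k _; rewrite mxE mulrDl. Qed.

Lemma dot_ge0 u : 0 <= dot u u.
Proof. by apply: sumr_ge0 => k _; rewrite -expr2 sqr_ge0. Qed.

Lemma dot_eq0 u : dot u u = 0 -> u = 0.
Proof.
move=> /eqP; rewrite psumr_eq0 => [/allP H|k _]; last by rewrite -expr2 sqr_ge0.
apply/rowP => k; have := H k (mem_index_enum _).
by rewrite /= mulf_eq0 orbb mxE => /eqP.
Qed.

Lemma linear_mx (f : 'rV[R]_7 -> 'rV[R]_7) : linear f -> exists A, forall u, u *m A = f u.
Proof.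
move=> lf; pose lin_f := GRing.isLinear.Build R _ _ *:%R f lf.
pose F : {linear 'rV[R]_7 -> 'rV[R]_7} := HB.pack f lin_f.
by exists (lin1_mx F) => u; rewrite mul_rV_lin1.
Qed.

(** The complex structure belonging to [omega1] on the complement of [ev 1], completed by the
    identity on [ev 1] to an invertible map. *)
Definition eps1 u : 'rV[R]_7 :=
  \row_k [:: dx 1 u; - dx 3 u; dx 2 u; - dx 5 u; dx 4 u; - dx 7 u; dx 6 u]`_k.

Lemma eps1_linear : linear eps1.
Proof.
by move=> a u v; apply: dx_ext7; rewrite dxD dxZ /eps1 !dx_list //= !dxD !dxZ; ring.
Qed.

Lemma eps1K u : eps1 (eps1 u) = (2 * dx 1 u) *: ev 1 - u.
Proof.
by apply: dx_ext7; rewrite dxB dxZ dx_ev // /eps1 !dx_list //=; ring.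
Qed.

Lemma dot_eps1 u v : dot (eps1 u) v = omega1 u v + dx 1 u * dx 1 v.
Proof. by rewrite dotE /eps1 !dx_list //= /omega1 /wedge2; ring. Qed.

(* After subtracting multiples of its first row from the others, [N] preserves the
   splitting of e_1 and its complement and scales the symplectic form [omega1] by
   [r^-1]; then compare determinants. *)
Lemma preserves_phi_det N (r : R) : preserves_phi N -> ev 1 *m N = r *: ev 1 ->
  \det N ^+ 2 * r ^+ 4 = 1.
Proof.
move=> HN N1.
have om u v : r * omega1 (u *m N) (v *m N) = omega1 u v.
  by rewrite -!phi0_ev1 -phi0Z1 -N1 HN.
have r0 : r != 0.
  apply/eqP => r0; have := om (ev 2) (ev 3); rewrite r0 mul0r /omega1 /wedge2 !dx_ev //=.
  by move/eqP; rewrite !(mulr0, mul0r, subr0, addr0, mulr1) eq_sym oner_eq0.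
have [K EK] := linear_mx eps1_linear.
have KN0 : \det K != 0.
  have : K *m K *m K *m K = 1%:M.
    apply: mx_act_ext => u; rewrite !mulmxA !EK mulmx1 !eps1K.
    by apply: dx_ext => k _; rewrite !(dxB, dxZ) [dx 1 (ev 1)]dx_ev //=; ring.
  move/(congr1 determinant); rewrite !det_mulmx det1 => E.
  by apply/eqP => d0; move/eqP: E; rewrite d0 mulr0 eq_sym oner_eq0.
(* [D] compensates the two scalings under [T *m N]: the square of the first coordinate gains
   [r ^+ 2] and [omega1] gains [r^-1]. *)
pose D : 'M[R]_7 := diag_mx (\row_k (if k == 0 then r ^- 2 else r)).
have dxD' u k : (0 < k < 8)%N -> dx k (u *m D) = dx k u * (if k == 1 then r ^- 2 else r)%N.
  case: k => // k k7; rewrite /dx /= /D mul_mx_diag !mxE.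
  by rewrite -val_eqE /= inordK.
have detD : \det D = r ^+ 4.
  rewrite det_diag big_ord_recl !mxE eqxx.
  under eq_bigr do rewrite mxE /=.
  by rewrite prodr_const card_ord; field.
(* The multiple of [ev 1] is chosen so that [f u *m N] has first coordinate [r * dx 1 u]. It
   vanishes at [u = ev 1], so [T] is unitriangular. *)
pose f u := u - (dx 1 (u *m N) / r - dx 1 u) *: ev 1.
have [T ET] : exists T, forall u, u *m T = f u.
  by apply: linear_mx => a u v; apply: dx_ext => k _;
    rewrite /f mulmxDl -scalemxAl !(dxD, dxB, dxN, dxZ); ring.
have Tij i j : T i j = (i == j)%:R
    - (dx 1 (('e_i : 'rV[R]_7) *m N) / r - dx 1 ('e_i : 'rV[R]_7)) * (j == 0)%:R.
  have -> : T i j = (('e_i : 'rV[R]_7) *m T) 0 j by rewrite -(rowE i T) mxE.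
  by rewrite ET !mxE eqxx (eq_sym j i).
have detT : \det T = 1.
  rewrite det_trig; last first.
    apply/is_trig_mxP => i j ij; rewrite Tij.
    have -> : (i == j) = false by rewrite -val_eqE /= ltn_eqF.
    have -> : (j == 0) = false by rewrite -val_eqE /= gtn_eqF // (leq_trans _ ij).
    by rewrite mulr0 subr0.
  rewrite big1 // => i _; rewrite Tij eqxx; case: eqVneq => [->|_]; last by rewrite mulr0 subr0.
  have -> : 'e_0 = ev 1 :> 'rV[R]_7 by apply/rowP => k; rewrite !mxE.
  by rewrite N1 dxZ !dx_ev //=; field.
have TN u k : (0 < k < 8)%N ->
    dx k (u *m (T *m N)) = if k == 1%N then r * dx 1 u else dx k (u *m N).
  move=> hk; rewrite mulmxA ET /f mulmxBl -scalemxAl N1 dxB !dxZ dx_ev //.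
  by case: eqVneq => [->|_] /=; [field|rewrite !mulr0 subr0].
have EQ : (T *m N) *m (K *m D) *m (T *m N)^T = K.
  apply: form_ext => u v.
  have -> : (u *m (T *m N *m (K *m D) *m (T *m N)^T) *m v^T) 0 0
     = dot (eps1 (u *m (T *m N)) *m D) (v *m (T *m N)).
    by rewrite dot_mx [in RHS]trmx_mul -EK !mulmxA.
  rewrite EK -dot_mx dot_eps1 -om /omega1 /wedge2 dotE !dxD' // /eps1 !dx_list //= !TN //=.
  by field.
move/(congr1 determinant): EQ; rewrite !det_mulmx det_tr det_mulmx detT mul1r detD => E.
by apply: (mulfI KN0); rewrite mulr1 -[RHS]E; ring.
Qed.

(** Successive uses of [kill] clear coordinates 2, 4, 7, then 4, 6, 3, then 7, 5, 3. Coordinates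
    already cleared are either outside the later block or cleared again. *)
Lemma sphere_move v : exists2 h, rot_gen h &
  exists2 r, 0 <= r & v *m h = r *: ev 1.
Proof.
have [h1 g1 [_ [b1 c1 d1] o1 _]] :=
  @kill _ 1 2 4 7 v isT circle_1247 circle_1472.
have [h2 g2 [_ [b2 c2 d2] o2 _]] :=
  @kill _ 1 4 6 3 (v *m h1) isT (@rot_gen1 R) circle_1634.
have [h3 g3 [a3 [b3 c3 d3] o3 _]] :=
  @kill _ 1 7 5 3 (v *m h1 *m h2) isT (@rot_gen6 R) circle_1537.
exists (h1 *m h2 *m h3); first by apply: rot_genM => //; apply: rot_genM.
exists (dx 1 (v *m h1 *m h2 *m h3)) => //; rewrite !mulmxA.
apply: dx_ext7; rewrite dxZ dx_ev //= ?mulr1 // mulr0 //.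
- by rewrite o3 // o2.
- by rewrite o3.
- by rewrite o3.
Qed.

(* Moving [u] and [u *m M] to multiples of [ev 1] reduces to [preserves_phi_det]. *)
Lemma g2_conformal M : (forall h, rot_gen h -> preserves_dot h /\ preserves_phi h) ->
  preserves_phi M ->
  forall u, dot (u *m M) (u *m M) ^+ 2 * \det M ^+ 2 = dot u u ^+ 2.
Proof.
move=> gP HM u; have [h1 g1 [r r0 E1]] := sphere_move u.
have [h1' [g1' h1K h1'K]] := rot_genV g1.
have uE : u = r *: (ev 1 *m h1') by rewrite scalemxAl -E1 -mulmxA h1K mulmx1.
have [h2 g2 [s s0 E2]] := sphere_move (ev 1 *m h1' *m M).
have [d1 p1] := gP _ g1'; have [d2 p2] := gP _ g2.
have := @preserves_phi_det (h1' *m M *m h2) s.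
rewrite !mulmxA E2 => /(_ _ erefl).
move=> /(_ (preserves_phiM (preserves_phiM p1 HM) p2)).
rewrite !det_mulmx !exprMn (preserves_dot_det d1) (preserves_dot_det d2) mul1r mulr1 => E.
rewrite {}uE -scalemxAl !dotZ !dotZr -d2 E2 d1 dotZ dotZr.
by rewrite !dot_ev // dx_ev //= -[X in _ = X]mulr1 -E; ring.
Qed.

(** By [g2_conformal] and polarization, [M] scales the scalar product by [c^-1] with [c] the
    absolute value of its determinant. Taking determinants gives [c ^+ 9 = 1], hence [c = 1]. *)
Lemma g2_orthogonal M : (forall h, rot_gen h -> preserves_dot h /\ preserves_phi h) ->
  preserves_phi M -> preserves_dot M.
Proof.
move=> gP HM; have conf := g2_conformal gP HM.
set c := `|\det M|; have c0 : 0 <= c by exact: normr_ge0.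
have Ec u : c * dot (u *m M) (u *m M) = dot u u.
  apply/eqP; rewrite -(@eqrXn2 _ 2) ?dot_ge0 ?mulr_ge0 ?dot_ge0 //.
  by rewrite exprMn mulrC -(conf u) /c real_normK ?num_real.
have dotD2 u v : dot (u + v) (u + v) = dot u u + dot v v + 2 * dot u v.
  by rewrite !dotE !dxD; ring.
have Ec2 u v : c * dot (u *m M) (v *m M) = dot u v.
  have := Ec (u + v); rewrite mulmxDl !dotD2 -(Ec u) -(Ec v) => E; lra.
have MM : c *: (M *m M^T) = 1%:M.
  apply: form_ext => u v; rewrite mulmx1; have := Ec2 u v; rewrite !dot_mx => <-.
  by rewrite trmx_mul -scalemxAr -scalemxAl [LHS]mxE !mulmxA.
have c1 : c = 1.
  have : c ^+ 9 = 1.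
    move/(congr1 determinant): MM; rewrite detZ det_mulmx det_tr det1 => <-.
    by rewrite -expr2 -[\det M ^+ 2]real_normK ?num_real // -/c -exprD.
  by move/eqP; rewrite pexpr_eq1 // => /eqP.
by move=> u v; have := Ec2 u v; rewrite c1 mul1r.
Qed.

(** Once [ev 1], [ev 2] and [ev 4] are fixed, the other coordinates are values of [phi0] with fixed
    vectors in two slots. The first hypothesis is later supplied by the invariance of [dot] and
    [phi0] under transport. *)
Theorem g2_rot_gen M : (forall h, rot_gen h -> preserves_dot h /\ preserves_phi h) ->
  preserves_phi M -> rot_gen M.
Proof.
move=> gP pM; have dM := g2_orthogonal gP pM.
suff [h gh Mh] : exists2 h, rot_gen h & M *m h = 1%:M.
  have [h' [gh' hK _]] := rot_genV gh.
  by rewrite (_ : M = h') // -[M]mulmx1 -hK mulmxA Mh mul1mx.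
have unit_r r k (A : 'M[R]_7) : (0 < k < 8)%N -> 0 <= r -> preserves_dot A ->
    ev k *m A = r *: ev k -> ev k *m A = ev k.
  move=> hk r0 /(_ (ev k) (ev k)) dA E; move: dA; rewrite E dotZ dotZr.
  rewrite dot_ev // dx_ev // eqxx !mulr1.
  by move=> /eqP; rewrite -expr2 sqrp_eq1 // => /eqP ->; rewrite scale1r.
have [h1 g1 [r r0 E1]] := sphere_move (ev 1 *m M).
have [d1 p1] := gP _ g1.
have [M1 M1E] : exists M1, M1 = M *m h1 by exists (M *m h1).
have dM1 : preserves_dot M1 by rewrite M1E; exact: preserves_dotM.
have pM1 : preserves_phi M1 by rewrite M1E; exact: preserves_phiM.
have {}E1 : ev 1 *m M1 = ev 1 by apply: (unit_r r) => //; rewrite M1E mulmxA.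
have v1 : dx 1 (ev 2 *m M1) = 0 by rewrite -dot_ev // -[X in dot _ X]E1 dM1 dot_ev // dx_ev.
(* Both blocks avoid coordinate 1, so [ev 1] stays fixed. The first clears 5, 6, 7; the second moves
   what remains into coordinate 2. *)
have [h2 g2 [_ [b2 c2 e2] o2 f2]] :=
  @kill _ 4 7 6 5 (ev 2 *m M1) isT circle_4765 circle_4657.
have [h3 g3 [a3 [b3 c3 e3] o3 f3]] :=
  @kill _ 2 5 4 3 (ev 2 *m M1 *m h2) isT circle_2543 circle_2435.
have [d2 p2] := gP _ g2; have [d3 p3] := gP _ g3.
have [M2 M2E] : exists M2, M2 = M1 *m h2 *m h3 by exists (M1 *m h2 *m h3).
have dM2 : preserves_dot M2 by rewrite M2E; apply: preserves_dotM => //; exact: preserves_dotM.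
have pM2 : preserves_phi M2 by rewrite M2E; apply: preserves_phiM => //; exact: preserves_phiM.
have {}E1 : ev 1 *m M2 = ev 1 by rewrite M2E !mulmxA E1 f2 ?dx_ev // f3 ?dx_ev.
have E2 : ev 2 *m M2 = ev 2.
  apply: (unit_r (dx 2 (ev 2 *m M2))) => //; first by rewrite M2E !mulmxA.
  rewrite M2E !mulmxA.
  apply: dx_ext7; rewrite dxZ dx_ev //= ?mulr1 // mulr0 //.
  - by rewrite o3 // o2.
  - by rewrite o3.
  - by rewrite o3.
have v41 : dx 1 (ev 4 *m M2) = 0 by rewrite -dot_ev // -[X in dot _ X]E1 dM2 dot_ev // dx_ev.
have v42 : dx 2 (ev 4 *m M2) = 0 by rewrite -dot_ev // -[X in dot _ X]E2 dM2 dot_ev // dx_ev.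
(* Orthogonality is not enough for coordinate 3, which is [phi0] evaluated on the fixed [ev 1] and
   [ev 2]. The image of [ev 4] then lies in the block 4765, which leaves [ev 1] and [ev 2] alone. *)
have v43 : dx 3 (ev 4 *m M2) = 0 by rewrite -phi0_ev12 -E1 -E2 pM2 phi0_ev12 dx_ev.
have [h4 g4 [a4 [b4 c4 e4] o4 f4]] :=
  @kill _ 4 7 6 5 (ev 4 *m M2) isT circle_4765 circle_4657.
have [d4 p4] := gP _ g4.
have [M3 M3E] : exists M3, M3 = M2 *m h4 by exists (M2 *m h4).
have dM3 : preserves_dot M3 by rewrite M3E; exact: preserves_dotM.
have pM3 : preserves_phi M3 by rewrite M3E; exact: preserves_phiM.
have {}E1 : ev 1 *m M3 = ev 1 by rewrite M3E !mulmxA E1 f4 ?dx_ev.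
have {}E2 : ev 2 *m M3 = ev 2 by rewrite M3E !mulmxA E2 f4 ?dx_ev.
have E4 : ev 4 *m M3 = ev 4.
  apply: (unit_r (dx 4 (ev 4 *m M3))) => //; first by rewrite M3E !mulmxA.
  rewrite M3E !mulmxA.
  by apply: dx_ext7; rewrite dxZ dx_ev //= ?mulr1 // mulr0 // o4.
exists (h1 *m h2 *m h3 *m h4).
  by apply: rot_genM => //; apply: rot_genM => //; apply: rot_genM.
have -> : M *m (h1 *m h2 *m h3 *m h4) = M3 by rewrite M3E M2E M1E !mulmxA.
have D k u : (0 < k < 8)%N -> ev k *m M3 = ev k -> dx k (u *m M3) = dx k u.
  by move=> hk Ek; rewrite -!dot_ev // -[X in dot _ X = _]Ek dM3.
have D1 u := D 1%N u isT E1; have D2 u := D 2%N u isT E2; have D4 u := D 4%N u isT E4.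
have D3 u : dx 3 (u *m M3) = dx 3 u.
  by rewrite -[LHS]phi0_ev12 -[X in phi0 X _ _]E1 -[X in phi0 _ X _]E2 pM3 phi0_ev12.
have D5 u : dx 5 (u *m M3) = dx 5 u.
  by rewrite -[LHS]phi0_ev14 -[X in phi0 X _ _]E1 -[X in phi0 _ X _]E4 pM3 phi0_ev14.
have D6 u : dx 6 (u *m M3) = dx 6 u.
  by rewrite -[LHS]phi0_ev24 -[X in phi0 X _ _]E2 -[X in phi0 _ X _]E4 pM3 phi0_ev24.
(* Coordinate 7 will come from [phi0] with [ev 1] and [ev 6]. Six coordinates of the image of [ev 6]
   are known, and its norm forces the seventh to vanish. *)
have E6 : ev 6 *m M3 = ev 6.
  apply: dx_ext7; rewrite ?(D1, D2, D3, D4, D5, D6) // [RHS]dx_ev //.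
  have := dM3 (ev 6) (ev 6); rewrite !dotE !(D1, D2, D3, D4, D5, D6) !dx_ev //= => /eqP.
  rewrite !(mulr0, add0r, addr0, mulr1) -subr_eq0 addrAC subrr add0r mulf_eq0 orbb.
  by move/eqP.
apply: mx_act_ext => u; rewrite mulmx1; apply: dx_ext7; rewrite ?(D1, D2, D3, D4, D5, D6) //.
by rewrite -[LHS]phi0_ev16 -[X in phi0 X _ _]E1 -[X in phi0 _ X _]E6 pM3 phi0_ev16.
Qed.

End Stabilizer.

(** * The Levi-Civita connection in the orthonormal coframe *)

Section DeriveRules.
Context {R : realType} {V : normedModType R}.
Implicit Types (f g : V -> R) (x v : V).

Lemma is_derive_opp_fun f x v (d : R) : is_derive x v f d -> is_derive x v (fun y => - f y) (- d).
Proof. by move=> ?; exact: is_deriveN. Qed.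

Lemma is_derive_cst_fun (a : R) x v : is_derive x v (fun=> a) 0.
Proof. exact: (is_derive_cst a). Qed.

End DeriveRules.

(* [is_derive] is a class: without [notypeclasses] the premises would be
   resolved by instances that produce derivatives in other forms. *)
Ltac derive_with tac := repeat first
  [ notypeclasses refine (is_derive_cst_fun _ _ _) | tac
  | notypeclasses refine (is_derive_add _ _) | notypeclasses refine (is_derive_opp_fun _)
  | notypeclasses refine (is_derive_mul _ _) | notypeclasses refine (is_derive_exp _) ].

Section Geometry.
Context {R : realType} (m : R) (m0 : m != 0).
Implicit Types (x u v w th : 'rV[R]_7).

(* The order and signs of the e^i for which [phi0] becomes parallel. *)
Definition reorder th : 'rV[R]_7 :=
  \row_k [:: dx 7 th; - dx 2 th; dx 3 th; dx 1 th; dx 4 th; dx 5 th; dx 6 th]`_k.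

Definition eps x u : 'rV[R]_7 := expR (- m * dx 7 x) *: reorder (coframe m x u).

(* [dcoframe x u v] and [deps x u v] are the derivatives at [x] along [u] of the
   forms [coframe m _] and [eps _] evaluated at the constant field [v]. *)
Definition dcoframe x u v : 'rV[R]_7 :=
  let t := dx 7 x in
  \row_k [:: (4 / 5) * m * dx 7 u * (expR ((4 / 5) * m * t) * dx 1 v);
         - (3 / 5) * m * expR ((6 / 5) * m * t)
           * ((6 / 5) * m * dx 7 u * eta2 x v + (2 / 3) * dx 4 u * dx 5 v);
         - (3 / 5) * m * expR ((7 / 5) * m * t)
           * ((7 / 5) * m * dx 7 u * eta3 x v - (2 / 3) * dx 1 u * dx 5 v
              + (2 / 3) * dx 4 u * dx 6 v);
         (3 / 5) * m * dx 7 u * (expR ((3 / 5) * m * t) * dx 4 v);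
         (3 / 5) * m * dx 7 u * (expR ((3 / 5) * m * t) * dx 5 v);
         (4 / 5) * m * dx 7 u * (expR ((4 / 5) * m * t) * dx 6 v);
         0]`_k.

Definition deps x u v : 'rV[R]_7 :=
  expR (- m * dx 7 x) *: (reorder (dcoframe x u v) - (m * dx 7 u) *: reorder (coframe m x v)).

(* The connection form: [th] lists the values of e^1, ..., e^7 on the direction
   of differentiation; e^7 does not contribute. *)
Definition conn th w : 'rV[R]_7 :=
  let a := dx 1 th in let b := dx 2 th in let c := dx 3 th in
  let d := dx 4 th in let f := dx 5 th in let g := dx 6 th in
  (m / 5) *: \row_k
    [:: a * dx 4 w + b * dx 2 w - 2 * c * dx 3 w + 2 * d * dx 5 w + 2 * f * dx 6 w + g * dx 7 w;
        - b * dx 1 w - d * dx 6 w + f * dx 5 w;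
        - a * dx 6 w + 2 * c * dx 1 w + d * dx 7 w + f * dx 4 w - g * dx 5 w;
        - a * dx 1 w - c * dx 6 w - f * dx 3 w;
        b * dx 6 w + c * dx 7 w - 2 * d * dx 1 w - f * dx 2 w + g * dx 3 w;
        a * dx 3 w - b * dx 5 w + c * dx 4 w + d * dx 2 w - 2 * f * dx 1 w;
        - c * dx 5 w - d * dx 3 w - g * dx 1 w]`_k.

(* The covariant derivative of the constant field [v] along [u], in the coframe. *)
Definition covd x u v : 'rV[R]_7 := deps x u v + conn (coframe m x u) (eps x v).

(** The connection form takes values in so(7): compatibility with the metric. *)
Lemma conn_dot th u v : dot (conn th u) v + dot u (conn th v) = 0.
Proof. by rewrite !dotE /conn !dxZ !dx_list //=; ring. Qed.

(** The connection form takes values in the Lie algebra of [G2], which makes [phi0] parallel. *)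
Lemma conn_phi th u v w :
  phi0 (conn th u) v w + phi0 u (conn th v) w + phi0 u v (conn th w) = 0.
Proof.
by rewrite /phi0 /wedge3 /wedge2 /conn !dxZ !dx_list //=; ring.
Qed.

Lemma reorder_linear : linear reorder.
Proof.
by move=> a u v; apply: dx_ext7; rewrite dxD dxZ /reorder !dx_list //= !dxD !dxZ; ring.
Qed.

Lemma eps_linear x : linear (eps x).
Proof.
by move=> a u v; rewrite /eps coframe_linear reorder_linear scalerDr !scalerA mulrC.
Qed.

Lemma dot_reorder u v : dot (reorder u) (reorder v) = dot u v.
Proof. by rewrite !dotE /reorder !dx_list //=; ring. Qed.

Lemma metric_eps x u v : metric m x u v = dot (eps x u) (eps x v).
Proof.
rewrite metric_coframe /eps dotZ dotZr mulrA -expRD dot_reorder.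
by congr (expR _ * _); ring.
Qed.

Lemma dcoframe_torsion x u v :
  dcoframe x u v - dcoframe x v u = s_de m (coframe m x u) (coframe m x v).
Proof.
apply: dx_ext => k kn; have := @coframe_structure _ m x u v (inord k).
rewrite /s_bracket mxE opprK /ext_d dxB.
have D w w' := @derive_val _ _ _ _ _ _ _ (@is_derive_coframe _ m x w w' k kn).
by rewrite -![_ 0 (inord k)]/(dx k.+1 _) !D /dcoframe !dx_list.
Qed.

Lemma conn_linear th : linear (conn th).
Proof.
by move=> a u v; apply: dx_ext7; rewrite dxD /conn !dxZ !dx_list //= !(dxD, dxZ); ring.
Qed.

Lemma connZ th (a : R) w : conn th (a *: w) = a *: conn th w.
Proof.
have := conn_linear th a w 0; rewrite addr0 => ->.
by have := conn_linear th (-1) 0 0; rewrite scaler0 addr0 scaleN1r addNr => ->; rewrite addr0.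
Qed.

(** Cartan's first structure equation for [eps], with the factor exp(-mt) removed; the terms in
    [dx 7] come from differentiating that factor. *)
Lemma torsion_free a b :
  reorder (s_de m a b) - (m * dx 7 a) *: reorder b + (m * dx 7 b) *: reorder a
  = conn b (reorder a) - conn a (reorder b).
Proof.
by apply: dx_ext7; rewrite !(dxD, dxB, dxN, dxZ) /conn ?dxZ /reorder /s_de
  !dx_list //= /wedge2; field.
Qed.

(** Vanishing torsion, as constant fields commute. *)
Lemma covd_sym x u v : covd x u v = covd x v u.
Proof.
have E w : dx 7 w = dx 7 (coframe m x w) by rewrite /coframe dx_list.
have := torsion_free (coframe m x u) (coframe m x v).
rewrite -dcoframe_torsion /covd /deps /eps !connZ -!scalerDr -!E.
have -> : reorder (dcoframe x u v - dcoframe x v u)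
    = reorder (dcoframe x u v) - reorder (dcoframe x v u).
  by rewrite addrC -scaleN1r reorder_linear scaleN1r addrC.
set a := conn _ _; set b := conn _ _; move: a b => a b.
set c := reorder _; set d := reorder _; set e := reorder _; set f := reorder _.
move: c d e f => c d e f H.
congr (_ *: _); apply: dx_ext => k _.
by have := congr1 (dx k.+1) H; rewrite !(dxD, dxB, dxN, dxZ) => H'; lra.
Qed.

(** Base point and vector both vary, so that the rule covers constant fields as well as fields along
    a curve. *)
Lemma is_derive_coframe_fun (V : normedModType R) (c W : V -> 'rV[R]_7) (p q : V) u w :
  (forall k, is_derive p q (fun y => dx k (c y)) (dx k u)) ->
  (forall k, is_derive p q (fun y => dx k (W y)) (dx k w)) ->
  forall k, (0 < k < 8)%N -> is_derive p q (fun y => dx k (coframe m (c y) (W y)))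
    (dx k (dcoframe (c p) u (W p) + coframe m (c p) w)).
Proof.
move=> hc hW; case=> // k k7; rewrite dxD /coframe /dcoframe !dx_list //.
under eq_fun do rewrite dx_list //.
have E (r : R) : is_derive p q (fun y => expR (r * m * dx 7 (c y)))
    (expR (r * m * dx 7 (c p)) * (r * m * dx 7 u)).
  notypeclasses refine (is_derive_exp _); notypeclasses refine (is_derive_eq _ _);
    first by derive_with ltac:(notypeclasses refine (hc _)).
  by cbv beta; ring.
have E2 : is_derive p q (fun y => eta2 (c y) (W y))
   (eta2 (c p) w + (2 / 3) * dx 4 u * dx 5 (W p)).
  rewrite /eta2; notypeclasses refine (is_derive_eq _ _);
    first by derive_with ltac:(first [notypeclasses refine (hc _)|apply: hW]).
  by cbv beta; ring.
have E3 : is_derive p q (fun y => eta3 (c y) (W y))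
   (eta3 (c p) w - (2 / 3) * dx 1 u * dx 5 (W p) + (2 / 3) * dx 4 u * dx 6 (W p)).
  rewrite /eta3; notypeclasses refine (is_derive_eq _ _);
    first by derive_with ltac:(first [notypeclasses refine (hc _)|apply: hW]).
  by cbv beta; ring.
case: k k7 => [|[|[|[|[|[|[|k]]]]]]] //= _; notypeclasses refine (is_derive_eq _ _).
all: try by derive_with ltac:(first [notypeclasses refine (E _)
  |notypeclasses refine E2|notypeclasses refine E3|apply: hW]).
all: by cbv beta; ring.
Qed.

Lemma is_derive_eps_fun (V : normedModType R) (c W : V -> 'rV[R]_7) (p q : V) u w :
  (forall k, is_derive p q (fun y => dx k (c y)) (dx k u)) ->
  (forall k, is_derive p q (fun y => dx k (W y)) (dx k w)) ->
  forall k, (0 < k < 8)%N -> is_derive p q (fun y => dx k (eps (c y) (W y)))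
    (dx k (deps (c p) u (W p) + eps (c p) w)).
Proof.
move=> hc hW.
have hE : is_derive p q (fun y => expR (- m * dx 7 (c y)))
    (expR (- m * dx 7 (c p)) * (- m * dx 7 u)).
  notypeclasses refine (is_derive_exp _); notypeclasses refine (is_derive_eq _ _).
    by derive_with ltac:(notypeclasses refine (hc _)).
  by cbv beta; ring.
have hth := is_derive_coframe_fun hc hW.
have E k y : (0 < k < 8)%N -> dx k (eps (c y) (W y))
    = expR (- m * dx 7 (c y)) * dx k (reorder (coframe m (c y) (W y))).
  by move=> hk; rewrite /eps dxZ.
case=> // k k7; under eq_fun do rewrite E //.
have D th : dx k.+1 (reorder th)
    = [:: dx 7 th; - dx 2 th; dx 3 th; dx 1 th; dx 4 th; dx 5 th; dx 6 th]`_k.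
  by rewrite /reorder dx_list.
under eq_fun do rewrite D.
rewrite /deps /eps dxD !dxZ dxB dxZ !D.
move: (dcoframe (c p) u (W p)) hth => dth hth {E D}.
case: k k7 => [|[|[|[|[|[|[|k]]]]]]] //= _; notypeclasses refine (is_derive_eq _ _).
all: try solve [derive_with ltac:(first [notypeclasses refine hE
  |notypeclasses refine (hth _ _); exact isT])].
all: by rewrite ?dxD; cbv beta; ring.
Qed.

Lemma is_derive_eps x u v k : (0 < k < 8)%N ->
  is_derive x u (fun y => dx k (eps y v)) (dx k (deps x u v)).
Proof.
move=> hk; have := @is_derive_eps_fun _ id (fun=> v) x u u 0.
move=> /(_ (fun l => is_derive_dx l x u)).
have H l : is_derive x u (fun=> dx l v) (dx l (0 : 'rV[R]_7)).
  by rewrite dx0; exact: is_derive_cst_fun.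
move=> /(_ H k hk) /=.
have -> : eps x 0 = 0 by have := eps_linear x (-1) 0 0; rewrite scaler0 addr0 scaleN1r addNr.
by rewrite addr0.
Qed.

Lemma is_derive_dot (V : normedModType R) (f g : V -> 'rV[R]_7) (p q : V) df dg :
  (forall k, (0 < k < 8)%N -> is_derive p q (fun y => dx k (f y)) (dx k df)) ->
  (forall k, (0 < k < 8)%N -> is_derive p q (fun y => dx k (g y)) (dx k dg)) ->
  is_derive p q (fun y => dot (f y) (g y)) (dot df (g p) + dot (f p) dg).
Proof.
move=> hf hg; under eq_fun do rewrite dotE.
notypeclasses refine (is_derive_eq _ _).
  by derive_with ltac:(first [notypeclasses refine (hf _ _); exact isT
    |notypeclasses refine (hg _ _); exact isT]).
by rewrite !dotE; cbv beta; ring.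
Qed.

Lemma is_derive_phi0 (V : normedModType R) (f g h : V -> 'rV[R]_7) (p q : V) df dg dh :
  (forall k, (0 < k < 8)%N -> is_derive p q (fun y => dx k (f y)) (dx k df)) ->
  (forall k, (0 < k < 8)%N -> is_derive p q (fun y => dx k (g y)) (dx k dg)) ->
  (forall k, (0 < k < 8)%N -> is_derive p q (fun y => dx k (h y)) (dx k dh)) ->
  is_derive p q (fun y => phi0 (f y) (g y) (h y))
    (phi0 df (g p) (h p) + phi0 (f p) dg (h p) + phi0 (f p) (g p) dh).
Proof.
move=> hf hg hh; rewrite /phi0 /wedge3 /wedge2.
notypeclasses refine (is_derive_eq _ _).
  by derive_with ltac:(first [notypeclasses refine (hf _ _); exact isT|
    notypeclasses refine (hg _ _); exact isT|notypeclasses refine (hh _ _); exact isT]).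
by cbv beta; ring.
Qed.

(** * The dual frame and the Christoffel symbols *)

Lemma linear_sum_basis (f : 'rV[R]_7 -> 'rV[R]_7) u : linear f ->
  f u = \sum_i u 0 i *: f 'e_i.
Proof.
move=> /linear_mx[A E]; rewrite -E mulmx_sum_row.
by apply: eq_bigr => i _; rewrite rowE E.
Qed.

Lemma dcoframe_linear x u : linear (dcoframe x u).
Proof.
move=> a v w; apply: dx_ext7; rewrite dxD dxZ /dcoframe !dx_list //=
  /eta2 /eta3 ?(dxD, dxZ); ring.
Qed.

Lemma deps_linear x u : linear (deps x u).
Proof.
move=> a v w; rewrite /deps dcoframe_linear coframe_linear !reorder_linear.
by apply: dx_ext => k _; rewrite !(dxD, dxB, dxN, dxZ); ring.
Qed.

Lemma covd_linear x u : linear (covd x u).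
Proof.
move=> a v w; rewrite /covd deps_linear eps_linear conn_linear.
by rewrite scalerDr !addrA; congr (_ + _); rewrite addrAC.
Qed.

(** Linearity in the first argument is obtained from the second by [covd_sym]. *)
Lemma covd_sum x u v :
  covd x u v = \sum_i \sum_j (u 0 i * v 0 j) *: covd x 'e_i 'e_j.
Proof.
rewrite covd_sym (linear_sum_basis _ (covd_linear x v)); apply: eq_bigr => i _.
rewrite covd_sym (linear_sum_basis _ (covd_linear x _)) scaler_sumr.
by apply: eq_bigr => j _; rewrite scalerA.
Qed.

Definition eps_mx x : 'M[R]_7 := \matrix_i eps x 'e_i.

Lemma mul_eps_mx x u : u *m eps_mx x = eps x u.
Proof.
rewrite mulmx_sum_row [RHS](linear_sum_basis _ (eps_linear x)).
by apply: eq_bigr => i _; rewrite rowK.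
Qed.

(** The inverse of [eps x], solved explicitly so that it can be differentiated along curves. *)
Definition frame x w : 'rV[R]_7 :=
  let l (k : R) := expR (k / 5 * m * dx 7 x) in
  let v5 := l 2 * dx 6 w in
  \row_k [:: l 1 * dx 4 w;
     5 / (3 * m) * (l (- 1) * dx 2 w) - (2 / 3) * dx 4 x * v5;
     - (5 / (3 * m)) * (l (- 2) * dx 3 w) + (2 / 3) * dx 1 x * v5
       - (2 / 3) * dx 4 x * (l 1 * dx 7 w);
     l 2 * dx 5 w; v5; l 1 * dx 7 w; l 5 * dx 1 w]`_k.

Lemma dx_frame x w k : (k < 7)%N -> dx k.+1 (frame x w) =
  [:: expR (1 / 5 * m * dx 7 x) * dx 4 w;
     5 / (3 * m) * (expR (- 1 / 5 * m * dx 7 x) * dx 2 w)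
       - (2 / 3) * dx 4 x * (expR (2 / 5 * m * dx 7 x) * dx 6 w);
     - (5 / (3 * m)) * (expR (- 2 / 5 * m * dx 7 x) * dx 3 w)
       + (2 / 3) * dx 1 x * (expR (2 / 5 * m * dx 7 x) * dx 6 w)
       - (2 / 3) * dx 4 x * (expR (1 / 5 * m * dx 7 x) * dx 7 w);
     expR (2 / 5 * m * dx 7 x) * dx 5 w;
     expR (2 / 5 * m * dx 7 x) * dx 6 w;
     expR (1 / 5 * m * dx 7 x) * dx 7 w;
     expR (5 / 5 * m * dx 7 x) * dx 1 w]`_k.
Proof. by move=> k7; rewrite /frame dx_list. Qed.

Lemma eps_frame x w : eps x (frame x w) = w.
Proof.
(* Every exponential involved is an integral power of [p], which leaves a rational identity to
   [field]. *)
pose p := expR (1 / 5 * m * dx 7 x).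
have p0 : p != 0 by rewrite gt_eqF ?expR_gt0.
have P (j : nat) : expR (j%:R / 5 * m * dx 7 x) = p ^+ j.
  by rewrite /p -expRM_natl; congr expR; ring.
have Q (j : nat) : expR (- j%:R / 5 * m * dx 7 x) = p ^- j.
  by rewrite -P -expRN; congr expR; ring.
have P5 : expR (- m * dx 7 x) = p ^- 5 by rewrite -Q; congr expR; field.
have P1 : expR (1 / 5 * m * dx 7 x) = p by [].
have P2 : expR (2 / 5 * m * dx 7 x) = p ^+ 2 := P 2%N.
have P3 : expR (3 / 5 * m * dx 7 x) = p ^+ 3 := P 3%N.
have P4 : expR (4 / 5 * m * dx 7 x) = p ^+ 4 := P 4%N.
have P5' : expR (5 / 5 * m * dx 7 x) = p ^+ 5 := P 5%N.
have P6 : expR (6 / 5 * m * dx 7 x) = p ^+ 6 := P 6%N.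
have P7 : expR (7 / 5 * m * dx 7 x) = p ^+ 7 := P 7%N.
have Q1 : expR (- 1 / 5 * m * dx 7 x) = p ^- 1 := Q 1%N.
have Q2 : expR (- 2 / 5 * m * dx 7 x) = p ^- 2 := Q 2%N.
rewrite /eps P5; apply: dx_ext7; rewrite dxZ /reorder dx_list //= /coframe dx_list //=
  /eta2 /eta3 /frame ?dx_list //= ?(P1, P2, P3, P4, P5', P6, P7, Q1, Q2); field; rewrite ?p0 ?m0 //.
Qed.

Lemma frame_linear x : linear (frame x).
Proof.
by move=> a u v; apply: dx_ext7; rewrite dxD dxZ /frame !dx_list //= !(dxD, dxZ); ring.
Qed.

Lemma eps_mx_unit x : eps_mx x \in unitmx.
Proof.
have [Q E] := linear_mx (frame_linear x).
have : Q *m eps_mx x = 1%:M.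
  by apply: mx_act_ext => u; rewrite mulmxA E mul_eps_mx eps_frame mulmx1.
by move/mulmx1_unit => [].
Qed.

Lemma eps_inj x : injective (eps x).
Proof.
by move=> u v; rewrite -!mul_eps_mx; apply: (can_inj (mulmxK (eps_mx_unit x))).
Qed.

Lemma frameE x w : frame x w = w *m invmx (eps_mx x).
Proof. by apply: (@eps_inj x); rewrite eps_frame -mul_eps_mx mulmxKV ?eps_mx_unit. Qed.

Lemma gram_eps x : gram (metric m) x = eps_mx x *m (eps_mx x)^T.
Proof.
apply/matrixP => i j; rewrite !mxE metric_eps; apply: eq_bigr => k _.
by rewrite !mxE.
Qed.

Lemma derive_gram x u i j : 'D_u (fun y => gram (metric m) y i j) x =
  dot (deps x u 'e_i) (eps x 'e_j) + dot (eps x 'e_i) (deps x u 'e_j).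
Proof.
under eq_fun do rewrite mxE metric_eps.
apply: (@derive_val _ _ _ _ _ _ _ _); apply: is_derive_dot => k hk; exact: is_derive_eps.
Qed.

(** Koszul's formula: by [conn_dot] each derivative of the metric is a sum of two [covd] terms, and
    by symmetry all but two equal ones cancel. *)
Lemma koszul x i j l :
  2^-1 * ('D_('e_i) (fun y => gram (metric m) y j l) x
     + 'D_('e_j) (fun y => gram (metric m) y i l) x
     - 'D_('e_l) (fun y => gram (metric m) y i j) x)
  = dot (eps x 'e_l) (covd x 'e_i 'e_j).
Proof.
have D u v w : dot (deps x u v) (eps x w) + dot (eps x v) (deps x u w)
    = dot (covd x u v) (eps x w) + dot (covd x u w) (eps x v).
  have := conn_dot (coframe m x u) (eps x v) (eps x w).
  rewrite /covd !dotDl (dotC (eps x v) (deps x u w)) (dotC (eps x v) (conn _ _)) => H.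
  by rewrite -[LHS]addr0 -H; ring.
rewrite !derive_gram !D (covd_sym x 'e_j 'e_i) (covd_sym x 'e_l 'e_i) (covd_sym x 'e_l 'e_j).
by rewrite (dotC (eps x 'e_l)); field.
Qed.

(** By [koszul] the column [G] of Christoffel symbols solves [E *m E^T *m G = E *m T^T]; cancelling
    [E] gives the claim. *)
Lemma eps_christoffel x i j :
  \sum_k christoffel (metric m) x k i j *: eps x 'e_k = covd x 'e_i 'e_j.
Proof.
pose T := covd x 'e_i 'e_j; pose E := eps_mx x; have uE := eps_mx_unit x.
have uG : gram (metric m) x \in unitmx by rewrite gram_eps unitmx_mul unitmx_tr uE.
pose G : 'cV[R]_7 := \col_k christoffel (metric m) x k i j.
have EG : G = invmx (gram (metric m) x) *m (E *m T^T).
  apply/matrixP => k z; rewrite !mxE /christoffel mulr_sumr; apply: eq_bigr => l _.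
  rewrite mulrCA koszul; congr (_ * _); rewrite mxE; apply: eq_bigr => a _.
  by rewrite !mxE.
have : E *m (E^T *m G) = E *m T^T by rewrite EG mulmxA -gram_eps mulKVmx.
move/(congr1 (mulmx (invmx E))); rewrite !mulKmx // => /(congr1 trmx).
rewrite trmx_mul !trmxK => H; rewrite -[RHS]/T -H mulmx_sum_row; apply: eq_bigr => k _.
by rewrite rowK !mxE.
Qed.

Lemma eps_christoffel_sum x u v :
  eps x (\row_k \sum_(i < 7) \sum_(j < 7)
           christoffel (metric m) x k i j * u 0 i * v 0 j) = covd x u v.
Proof.
rewrite (linear_sum_basis _ (eps_linear x)) covd_sum.
under eq_bigr do rewrite mxE scaler_suml.
rewrite exchange_big; apply: eq_bigr => i _.
under eq_bigr do rewrite scaler_suml.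
rewrite exchange_big; apply: eq_bigr => j _.
rewrite -eps_christoffel scaler_sumr; apply: eq_bigr => k _.
by rewrite scalerA; congr (_ *: _); ring.
Qed.

End Geometry.

(** * Parallel transport and holonomy *)

Section Transport.
Context {R : realType} (m : R) (m0 : m != 0).
Implicit Types (x p q u v w th : 'rV[R]_7) (c V : R -> 'rV[R]_7).

Lemma unit_interval_const (F : R -> R) :
  (forall s : R, 0 <= s <= 1 -> is_derive s 1 F 0) -> F 1 = F 0.
Proof.
move=> H; have := @MVT_segment R F (fun=> 0) 0 1 ler01.
have H1 (x : R) : x \in `]0, 1[ -> is_derive x 1 F 0.
  by rewrite in_itv /= => /andP[? ?]; apply: H; rewrite !ltW.
move=> /(_ H1) []; last by move=> z _; rewrite mul0r => /eqP; rewrite subr_eq0 => /eqP.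
apply: derivable_within_continuous => x; rewrite in_itv /= => hx.
exact: (@ex_derive _ _ _ _ _ _ _ (H x hx)).
Qed.

Definition velocity c (s : R) : 'rV[R]_7 := \row_i derive1 (fun r : R => c r 0 i) s.

Lemma is_derive_curve c (s : R) k : smooth_curve c ->
  is_derive s 1 (fun r : R => dx k (c r)) (dx k (velocity c s)).
Proof.
move=> /(_ (inord k.-1))/(_ 1%N) [_ /(_ 1)[/(_ s) d _]].
by rewrite /dx mxE derive1E; exact: derivableP.
Qed.

(** The Christoffel term contributes [- covd], whose part [deps] cancels the derivative of the
    coframe; only the connection form survives. *)
Lemma parallel_eps c V (s : R) : smooth_curve c -> parallel_along (metric m) c V -> 0 <= s <= 1 ->
  forall k, (0 < k < 8)%N -> is_derive s 1 (fun r : R => dx k (eps m (c r) (V r)))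
    (dx k (- conn m (coframe m (c s) (velocity c s)) (eps m (c s) (V s)))).
Proof.
move=> sc pV hs k hk.
set chi : 'rV[R]_7 := \row_k \sum_(i < 7) \sum_(j < 7)
  christoffel (metric m) (c s) k i j * velocity c s 0 i * V s 0 j.
have hV l : is_derive s 1 (fun r : R => dx l (V r)) (dx l (- chi)).
  notypeclasses refine (is_derive_eq (pV s hs (inord l.-1)) _).
  rewrite dxN /dx mxE; congr (- _); apply: eq_bigr => i _; apply: eq_bigr => j _.
  by rewrite [velocity _ _ _ _]mxE.
have := is_derive_eps_fun m (fun l => is_derive_curve s l sc) hV hk.
rewrite (_ : eps m (c s) (- chi) = - eps m (c s) chi); last first.
  by rewrite -!mul_eps_mx mulNmx.
by rewrite /chi eps_christoffel_sum // /covd opprD addrA subrr sub0r.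
Qed.

(** Along an arc both quantities have zero derivative, by [conn_dot] and [conn_phi]. *)
Lemma transport_preserves p q A : transport (metric m) p q A ->
  (forall u v, dot (eps m q (u *m A)) (eps m q (v *m A)) = dot (eps m p u) (eps m p v)) /\
  (forall u v w, phi0 (eps m q (u *m A)) (eps m q (v *m A)) (eps m q (w *m A))
     = phi0 (eps m p u) (eps m p v) (eps m p w)).
Proof.
elim=> [c B sc H|p1 p2 p3 B C _ [d1 f1] _ [d2 f2]]; last first.
  by split=> *; rewrite !mulmxA ?d2 ?d1 ?f2 ?f1.
split=> [u v|u v w].
  have [U pU [<- <-]] := H u; have [V pV [<- <-]] := H v.
  apply: (@unit_interval_const (fun r : R => dot (eps m (c r) (U r)) (eps m (c r) (V r)))).
  move=> s hs; notypeclasses refine (is_derive_eq _ _).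
    exact: is_derive_dot (parallel_eps sc pU hs) (parallel_eps sc pV hs).
  rewrite -[RHS]oppr0 -(conn_dot m (coframe m (c s) (velocity c s)) (eps m (c s) (U s))
    (eps m (c s) (V s))).
  have dotN a b : (dot (- a) b = - dot a b) * (dot a (- b) = - dot a b).
    by split; rewrite !dotE !dxN; ring.
  by rewrite !dotN opprD.
have [U pU [<- <-]] := H u; have [V pV [<- <-]] := H v; have [W pW [<- <-]] := H w.
apply: (@unit_interval_const (fun r : R =>
  phi0 (eps m (c r) (U r)) (eps m (c r) (V r)) (eps m (c r) (W r)))).
move=> s hs; notypeclasses refine (is_derive_eq _ _).
  exact: is_derive_phi0 (parallel_eps sc pU hs) (parallel_eps sc pV hs) (parallel_eps sc pW hs).
rewrite -[RHS]oppr0 -(conn_phi m (coframe m (c s) (velocity c s)) (eps m (c s) (U s))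
  (eps m (c s) (V s)) (eps m (c s) (W s))).
have phiN a b d : (phi0 (- a) b d = - phi0 a b d) * (phi0 a (- b) d = - phi0 a b d) *
    (phi0 a b (- d) = - phi0 a b d).
  by split; [split|]; rewrite /phi0 /wedge3 /wedge2 !dxN; ring.
by rewrite !phiN !opprD.
Qed.

(** Transport read in the orthonormal coframes at both ends, so that matrices for different base
    points can be multiplied. *)
Definition frame_transport p q (M : 'M[R]_7) :=
  transport (metric m) p q (eps_mx m p *m M *m invmx (eps_mx m q)).

Lemma frame_transport_cat p q r (M N : 'M[R]_7) :
  frame_transport p q M -> frame_transport q r N -> frame_transport p r (M *m N).
Proof.
move=> HM HN; have := transport_cat HM HN; rewrite /frame_transport.
by rewrite !mulmxA mulmxKV ?eps_mx_unit.
Qed.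

Lemma smooth_line p u : smooth_curve (fun s : R => p + s *: u).
Proof.
move=> i; rewrite (_ : (fun _ => _) = fun s : R => p 0 i + s * u 0 i).
  apply: smoothD; first exact: smooth_cst.
  apply: smoothM; last exact: smooth_cst.
  by move=> k; apply: Ck_lin => // x; exact: cvg_id.
by apply/funext => s; rewrite !mxE.
Qed.

Lemma velocity_line p u (s : R) : velocity (fun s : R => p + s *: u) s = u.
Proof.
apply/rowP => i; rewrite mxE derive1E.
rewrite (_ : (fun _ => _) = fun s : R => p 0 i + s * u 0 i); last first.
  by apply/funext => r; rewrite !mxE.
apply: (@derive_val _ _ _ _ _ _ _ _); notypeclasses refine (is_derive_eq _ _).
  by derive_with ltac:(notypeclasses refine (is_derive_id _ _)).
by cbv beta; ring.
Qed.

(** Differentiability suffices: [line_transport] recovers the value of the derivative by applying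
    [eps]. *)
Lemma is_derive_frame (c W : R -> 'rV[R]_7) (s : R) u w :
  (forall k, is_derive s 1 (fun r : R => dx k (c r)) (dx k u)) ->
  (forall k, (0 < k < 8)%N -> is_derive s 1 (fun r : R => dx k (W r)) (dx k w)) ->
  exists v, forall k, is_derive s 1 (fun r : R => dx k (frame m (c r) (W r))) (dx k v).
Proof.
move=> hc hW.
have hE (q : R) : is_derive s 1 (fun r : R => expR (q * m * dx 7 (c r)))
    (expR (q * m * dx 7 (c s)) * (q * m * dx 7 u)).
  notypeclasses refine (is_derive_exp _); notypeclasses refine (is_derive_eq _ _).
    by derive_with ltac:(notypeclasses refine (hc _)).
  by cbv beta; ring.
have H k : (0 < k < 8)%N -> exists d, is_derive s 1 (fun r : R => dx k (frame m (c r) (W r))) d.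
  case: k => // k k7; rewrite (funext (fun r : R => dx_frame m (c r) (W r) k7)).
  by case: k k7 => [|[|[|[|[|[|[|k]]]]]]] //= _; eexists;
    derive_with ltac:(first [notypeclasses refine (hE _)|notypeclasses refine (hc _)
      |notypeclasses refine (hW _ _); exact isT]).
exists (\row_i 'D_1 (fun r : R => dx i.+1 (frame m (c r) (W r))) s) => k.
rewrite [dx k (\row_i _)]/dx mxE.
(* [inord] sends an index out of range to the first coordinate, which reduces any [k] to the range 1
   to 7. *)
have E r : dx k (frame m (c r) (W r)) = dx (inord k.-1 : 'I_7).+1 (frame m (c r) (W r)).
  by rewrite /dx inord_val.
under eq_fun do rewrite E.
have [|d hd] := H (inord k.-1 : 'I_7).+1; first by rewrite ltn0Sn ltnS ltn_ord.
by apply: derivableP; exact: (@ex_derive _ _ _ _ _ _ _ hd).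
Qed.

(** Along a line of constant coframe velocity the parallel equation has constant coefficients in the
    coframe; the solution [w *m M r] is carried back by [frame]. *)
Lemma line_transport p u (M : R -> 'M[R]_7) th :
  (forall s : R, coframe m (p + s *: u) u = th) -> M 0 = 1%:M ->
  (forall w (s : R) k, (0 < k < 8)%N -> is_derive s 1 (fun r : R => dx k (w *m M r))
     (dx k (- conn m th (w *m M s)))) ->
  frame_transport p (p + u) (M 1).
Proof.
move=> Hth M1 HM; pose c s : 'rV[R]_7 := p + s *: u.
have pE : p = c 0 by rewrite /c scale0r addr0.
have qE : p + u = c 1 by rewrite /c scale1r.
rewrite qE [X in frame_transport X]pE; apply: transport_arc; first exact: smooth_line.
move=> v; pose W r := eps m p v *m M r; pose V r := frame m (c r) (W r).
exists V; last first.
  split; first by apply: (@eps_inj _ m m0 p); rewrite /V -pE eps_frame // /W M1 mulmx1.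
  by rewrite /V /W frameE // -pE -mul_eps_mx !mulmxA.
move=> s hs k.
have hc l : is_derive s 1 (fun r : R => dx l (c r)) (dx l u).
  by rewrite -[X in dx l X](velocity_line p u s); apply: is_derive_curve; exact: smooth_line.
have hW l : (0 < l < 8)%N ->
    is_derive s 1 (fun r : R => dx l (W r)) (dx l (- conn m th (W s))) := HM _ s l.
have [v' hV] : exists v', forall l, is_derive s 1 (fun r : R => dx l (V r)) (dx l v') :=
  is_derive_frame hc hW.
(* Two computations of the derivative of [eps m (c r) (V r) = W r]; injectivity of [eps] then
   identifies [v']. *)
have E : deps m (c s) u (V s) + eps m (c s) v' = - conn m th (W s).
  apply: dx_ext => l l7'; have l7 : (0 < l.+1 < 8)%N by [].
  rewrite -(@derive_val _ _ _ _ _ _ _ (is_derive_eps_fun m hc hV l7)).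
  rewrite -(@derive_val _ _ _ _ _ _ _ (hW l.+1 l7)).
  by congr ('D_1 _ s); apply/funext => r; rewrite /V eps_frame.
set chi : 'rV[R]_7 := \row_k \sum_(i < 7) \sum_(j < 7)
  christoffel (metric m) (c s) k i j * velocity c s 0 i * V s 0 j.
have v'E : v' = - chi.
  apply: (@eps_inj _ m m0 (c s)); rewrite -[RHS]mul_eps_mx mulNmx mul_eps_mx.
  rewrite /chi eps_christoffel_sum // velocity_line /covd Hth /V eps_frame // -/(V s).
  by rewrite opprD -E addrA addNr add0r.
have := hV k.+1; rewrite v'E dxN /dx inord_val mxE.
under [in X in X -> _]eq_bigr do under eq_bigr do rewrite mxE.
by [].
Qed.

End Transport.

(** * Rectangular loops and the holonomy group *)

Section Holonomy.
Context {R : realType} (m : R) (m0 : m != 0).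
Implicit Types (x p q u v w th : 'rV[R]_7).

(** The connection form has no e^7 component. *)
Lemma horizontal_transport p (tau : R) : frame_transport m p (p + tau *: ev 7) 1%:M.
Proof.
apply: (@line_transport _ m m0 p (tau *: ev 7) (fun=> 1%:M) (tau *: ev 7)) => //.
  by move=> s; apply: dx_ext7; rewrite /coframe dx_list //= /eta2 /eta3 !dxZ !dx_ev //=; ring.
move=> w s k hk; rewrite (_ : dx k (- _) = 0); first exact: is_derive_cst_fun.
by move: k hk; apply: coord_ind; rewrite dxN /conn dxZ dx_list //= !dxZ !dx_ev //=; ring.
Qed.

(** Expresses that [G t] is exp(-t L_i): [5 / m] cancels the factor [m / 5] of [conn], and [a] is
    the angular speed. *)
Definition generated_by (i : nat) (G : R -> 'M[R]_7) :=
  forall w (a s : R) k, (0 < k < 8)%N -> is_derive s 1 (fun r : R => dx k (w *m G (r * a)))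
    (dx k (- conn m ((5 / m * a) *: ev i) (w *m G (s * a)))).

(* Of the sides of a rectangle along e_7 and e_i only those along e_i turn the
   frame; going up by [tau] doubles the angle. *)
Lemma rectangle_holonomy (G : R -> 'M[R]_7) (i : nat) (q l : R) : q != 0 -> l != 0 ->
  G 0 = 1%:M -> (forall s t, G s *m G t = G (s + t)) ->
  generated_by i G ->
  (forall p, exists u0, forall a tau s : R,
     coframe m (p + tau *: ev 7 + s *: (a *: u0)) (a *: u0)
     = (a * q * expR (l * m * (dx 7 p + tau))) *: ev i) ->
  forall p t, frame_transport m p p (G t).
Proof.
move=> q0 l0 G0 GD dG dir p t; have [u0 Hu] := dir p.
have e0 (z : R) : expR z != 0 by rewrite gt_eqF ?expR_gt0.
(* With this [tau] the exponential factor doubles, and with [a] below the side at the level of [p]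
   turns by the angle [t]. The loop thus turns by 2t - t. *)
pose tau := ln 2 / (l * m).
pose a := t * (5 / m) / (q * expR (l * m * dx 7 p)).
have E2 : expR (l * m * (dx 7 p + tau)) = 2 * expR (l * m * dx 7 p).
  rewrite mulrDr expRD mulrC (_ : l * m * tau = ln 2) ?lnK ?posrE //.
  by rewrite /tau; field; rewrite l0 m0.
pose p1 := p + tau *: ev 7; pose u := a *: u0.
have T1 : frame_transport m p p1 1%:M := horizontal_transport p tau.
have T2 : frame_transport m p1 (p1 + u) (G (1 * (2 * t))).
  apply: (@line_transport _ m m0 p1 u (fun s => G (s * (2 * t))) ((5 / m * (2 * t)) *: ev i)
    _ _ (fun w s k hk => dG w (2 * t) s k hk)).
  - move=> s; rewrite /p1 /u Hu E2; congr (_ *: _); rewrite /a; field.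
    by rewrite q0 m0 e0.
  - by rewrite mul0r.
have T3 : frame_transport m (p1 + u) (p + u) 1%:M.
  have := horizontal_transport (p1 + u) (- tau).
  by rewrite /p1 scaleNr addrAC addrK.
have T4 : frame_transport m (p + u) p (G (1 * - t)).
  have {2}-> : p = p + u + - u by rewrite addrK.
  apply: (@line_transport _ m m0 (p + u) (- u) (fun s => G (s * - t)) ((5 / m * - t) *: ev i)
    _ _ (fun w s k hk => dG w (- t) s k hk)).
  (* The side is traversed backwards from [p + u], hence the shifted parameter [s - 1]. *)
  - move=> s; have := Hu (- a) 0 (s - 1).
    have -> : p + 0 *: ev 7 + (s - 1) *: (- a *: u0) = p + u + s *: - u.
      by apply: dx_ext => k _; rewrite /u !(dxD, dxN, dxZ); ring.
    rewrite scaleNr -/u addr0 => ->; congr (_ *: _); rewrite /a; field.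
    by rewrite q0 m0 e0.
  - by rewrite mul0r.
have := frame_transport_cat m0 T1 (frame_transport_cat m0 T2 (frame_transport_cat m0 T3 T4)).
by rewrite !mul1mx !mul1r GD (_ : 2 * t + - t = t) //; ring.
Qed.

Lemma is_derive_trig (a s : R) :
  is_derive s 1 (fun r : R => cos (r * a)) (- sin (s * a) * a) /\
  is_derive s 1 (fun r : R => sin (r * a)) (cos (s * a) * a).
Proof.
have da : is_derive s 1 (fun r : R => r * a) a.
  notypeclasses refine (is_derive_eq _ _).
    by derive_with ltac:(notypeclasses refine (is_derive_id _ _)).
  by cbv beta; ring.
split.
  exact: (@is_derive1_comp _ cos _ _ _ _ (is_derive_cos _) da).
exact: (@is_derive1_comp _ sin _ _ _ _ (is_derive_sin _) da).
Qed.

(** Replacing cosine and sine by functions [c], [s] with the same differential equations, and the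
    rotated vector by its coordinates, leaves a polynomial check. *)
Lemma generated_by_acts (i : nat) (G : R -> 'M[R]_7) (F : R -> R -> (nat -> R) -> nat -> R) :
  (forall t, acts (G t) (F (cos t) (sin t))) ->
  (forall (f : nat -> R) (c s : R -> R) (r a : R) (w : 'rV[R]_7) k, (0 < k < 8)%N ->
     is_derive r 1 c (- s r * a) -> is_derive r 1 s (c r * a) ->
     (forall j, (0 < j < 8)%N -> dx j w = F (c r) (s r) f j) ->
     is_derive r 1 (fun r : R => F (c r) (s r) f k) (dx k (- conn m ((5 / m * a) *: ev i) w))) ->
  generated_by i G.
Proof.
move=> aG H w a s k hk; have [dc ds] := is_derive_trig a s.
rewrite (funext (fun r : R => proj1 (aG (r * a)) w k hk)).
apply: (H (fun l => dx l w) (fun r => cos (r * a)) (fun r => sin (r * a)) s a) => //.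
by move=> j hj; have [act _] := aG (s * a); exact: act.
Qed.

Ltac generated_tac :=
  intros f c s r a w k hk dc ds E; revert k hk;
  pose proof (E 1%N isT) as E1; pose proof (E 2%N isT) as E2; pose proof (E 3%N isT) as E3;
  pose proof (E 4%N isT) as E4; pose proof (E 5%N isT) as E5; pose proof (E 6%N isT) as E6;
  pose proof (E 7%N isT) as E7;
  apply: coord_ind; rewrite dxN /conn dxZ dx_list //= !dxZ !dx_ev //=
    ?(E1, E2, E3, E4, E5, E6, E7) /rot_coord /=;
  (notypeclasses refine (is_derive_eq _ _);
  [derive_with ltac:(first [notypeclasses refine dc|notypeclasses refine ds])
  |cbv beta; field; exact: m0]).

Lemma generated1 : generated_by 1 (rotm 1 4 6 3).
Proof. by apply: generated_by_acts => [t|]; [exact: acts_rot|generated_tac]. Qed.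

Lemma generated2 : generated_by 2 (rotm 1 2 5 6).
Proof. by apply: generated_by_acts => [t|]; [exact: acts_rot|generated_tac]. Qed.

Lemma generated6 : generated_by 6 (rotm 1 7 5 3).
Proof. by apply: generated_by_acts => [t|]; [exact: acts_rot|generated_tac]. Qed.

(** L_3 turns the plane of coordinates 3 and 1 twice as fast as the other two planes, as the shared
    plane of the two factors does. *)
Lemma generated3 : generated_by 3 (fun t => rotm 3 1 6 4 t *m rotm 3 1 5 7 t).
Proof.
apply: (@generated_by_acts _ _ (fun co si f =>
  rot_coord 3 1 5 7 co si (rot_coord 3 1 6 4 co si f))).
  by move=> t; apply: acts_mul; exact: acts_rot.
generated_tac.
Qed.

(** In each case [q] and [l] are the constant factor and the exponent of e^i in [coframe]. *)
Lemma rot_gen_frame_transport A : rot_gen A -> forall p, frame_transport m p p A.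
Proof.
have q0 : - (3 / 5) * m != 0.
  by rewrite mulf_neq0 // oppr_eq0 mulf_neq0 ?invr_eq0 ?pnatr_eq0.
(* The successors ensure that the quotient is nonzero; [l0 3 4] stands for 4/5. *)
have l0 (a b : nat) : a.+1%:R / b.+1%:R != 0 :> R.
  by rewrite mulf_neq0 ?invr_eq0 ?pnatr_eq0.
elim=> [t|t|t|t|A1 A2 _ H1 _ H2] p.
- apply: (@rectangle_holonomy (rotm 1 4 6 3) 1 1 (4 / 5) (oner_neq0 _) (l0 3 4)%N) => //.
  + exact: rotm0.
  + by move=> *; exact: rotm_add.
  + exact: generated1.
  move=> p'; exists (ev 1) => a tau s.
  by apply: dx_ext7; rewrite dxZ /coframe dx_list //= /eta2 /eta3 !(dxD, dxZ)
    !dx_ev //= ?(mulr0, mulr1, addr0); ring.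
- apply: (@rectangle_holonomy (rotm 1 2 5 6) 2 (- (3 / 5) * m) (6 / 5) q0 (l0 5 4)%N) => //.
  + exact: rotm0.
  + by move=> *; exact: rotm_add.
  + exact: generated2.
  move=> p'; exists (ev 2) => a tau s.
  by apply: dx_ext7; rewrite dxZ /coframe dx_list //= /eta2 /eta3 !(dxD, dxZ)
    !dx_ev //= ?(mulr0, mulr1, addr0); ring.
- apply: (@rectangle_holonomy (rotm 1 7 5 3) 6 1 (4 / 5) (oner_neq0 _) (l0 3 4)%N) => //.
  + exact: rotm0.
  + by move=> *; exact: rotm_add.
  + exact: generated6.
  (* The [ev 3] component cancels the x_4 dx_6 term of [eta3]; x_4 is constant along the motion. *)
  move=> p'; exists (ev 6 - (2 / 3 * dx 4 p') *: ev 3) => a tau s.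
  by apply: dx_ext7; rewrite dxZ /coframe dx_list //= /eta2 /eta3
    !(dxD, dxB, dxN, dxZ) !dx_ev //= ?(mulr0, mulr1, addr0, subr0); ring.
- apply: (@rectangle_holonomy (fun t => rotm 3 1 6 4 t *m rotm 3 1 5 7 t) 3
    (- (3 / 5) * m) (7 / 5) q0 (l0 6 4)%N) => //.
  + by rewrite !rotm0 mulmx1.
  + move=> a b; rewrite -(@rotm_add R 3 1 6 4 a b) // -(@rotm_add R 3 1 5 7 a b) //.
    by rewrite !mulmxA -[X in X *m _ = _]mulmxA rotm_comm3 mulmxA.
  + exact: generated3.
  move=> p'; exists (ev 3) => a tau s.
  by apply: dx_ext7; rewrite dxZ /coframe dx_list //= /eta2 /eta3 !(dxD, dxZ)
    !dx_ev //= ?(mulr0, mulr1, addr0); ring.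
- exact: frame_transport_cat.
Qed.

Lemma holonomy_metric : holonomy_is_G2 (metric m).
Proof.
move=> p; exists (invmx (eps_mx m p)).
  move=> i j; rewrite !rowE metric_eps -!mul_eps_mx !mulmxKV ?eps_mx_unit // /dot.
  rewrite (bigD1 i) //= !mxE !eqxx mul1r big1 ?addr0 1?eq_sym //.
  by move=> k /negPf ki; rewrite !mxE ki /= mul0r.
have uE := eps_mx_unit m0 p.
have iso A : frame_transport m p p A -> preserves_dot A /\ preserves_phi A.
  move=> /transport_preserves-/(_ m0)[d f].
  have E u : eps m p (frame m p u *m (eps_mx m p *m A *m invmx (eps_mx m p))) = u *m A.
    by rewrite -mul_eps_mx frameE // !mulmxA !mulmxKV.
  by split=> [u v|u v w]; rewrite -!E ?d ?f !eps_frame.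
move=> A; rewrite invmxK; set N := invmx _ *m A *m _.
have AE : A = eps_mx m p *m N *m invmx (eps_mx m p).
  by rewrite /N !mulmxA mulmxV // mul1mx -mulmxA mulmxV // mulmx1.
split=> [HA|[_ HN]].
  have [d f] : preserves_dot N /\ preserves_phi N by apply: iso; rewrite /frame_transport -AE.
  by split=> //; have [] := mulmx1_unit (preserves_dot_mx d).
rewrite /holonomy AE; apply: rot_gen_frame_transport.
(* Generators are themselves holonomies in the frame, so [iso] gives their invariance. *)
apply: g2_rot_gen HN => h gh; apply: iso; exact: rot_gen_frame_transport.
Qed.

Lemma riemannian_metric : riemannian (metric m).
Proof.
split.
- move=> x u a v w; rewrite /= !metric_eps eps_linear.
  by rewrite !(dotC (eps m x u)) dotDl dotZ.
- by move=> x u v; rewrite !metric_eps dotC.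
- move=> x u u0; rewrite metric_eps lt_def dot_ge0 andbT.
  apply: contraNneq u0 => /dot_eq0 E; apply/eqP; apply: (@eps_inj _ m m0 x).
  by rewrite E -mul_eps_mx mul0mx.
- move=> u v; rewrite /metric /eta2 /eta3.
  by repeat first [exact: smooth_dx | exact: smooth_cst
    | apply: smoothD | apply: smoothM | apply: smoothN | apply: smooth_expR].
Qed.

End Holonomy.

Unset Implicit Arguments.

Theorem proposition5p1 (R : realType) (m : R) (hm : m != 0)
    (S : lie_group R 7) (hS : solvable_group_S m S) :
  riemannian (metric m) /\ holonomy_is_G2 (metric m).
Proof. by split; [exact: riemannian_metric|exact: holonomy_metric]. Qed.
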